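(* Let $d\ge 1$ and let $X$ and $W$ be independent log-concave random vectors in $\mathbb{R}^d$. Then for every $\lambda\in(0,1)$, $$f_{X+W}\preceq f_{\lambda X+W},$$ and consequently $h_\alpha(\lambda X+W)\le h_\alpha(X+W)$ for all $\alpha\in(0,\infty)$.
   Context: $f_Y$ denotes the density of a random vector $Y$ with respect to Lebesgue measure on $\mathbb{R}^d$. A random vector is log-concave if it has a density of the form $e^{-\phi}$ with $\phi:\mathbb{R}^d\to(-\infty,\infty]$ convex. Rényi entropy: for $Y$ with density $f$, $h_\alpha(Y)=\frac{1}{1-\alpha}\log\int_{\mathbb{R}^d} f^\alpha$ for $\alpha\in(0,1)\cup(1,\infty)$, and $h_1(Y)=-\int f\log f$ (natural logarithm). Rearrangement and majorization: for a Borel set $A$ of positive finite volume, $A^*$ is the open Euclidean ball centered at $0$ with the same volume as $A$. For a nonnegative measurable $f$ vanishing at infinity, its symmetrically decreasing rearrangement $f^*$ is the (a.e. unique) function with $\{f^*>t\}=\{f>t\}^*$ for all $t>0$. For probability densities $f,g$ on $\mathbb{R}^d$, $f\preceq g$ (''$f$ is majorized by $g$'') means $\int_{B(0,r)}f^*\,dx\le\int_{B(0,r)}g^*\,dx$ for all $r>0$, where $B(0,r)$ is the open Euclidean ball of radius $r$ centered at $0$. *)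

(* Defs.v *)
From HB Require Import structures.
From mathcomp Require Import all_boot all_order all_algebra.
From mathcomp Require Import all_classical all_reals all_analysis.

Set Implicit Arguments.
Unset Strict Implicit.
Unset Printing Implicit Defensive.
Import Order.TTheory GRing.Theory Num.Theory.
Import numFieldNormedType.Exports.

Local Open Scope classical_set_scope.
Local Open Scope ring_scope.

(* 'rV[R]_n carries the sigma-algebra generated by the coordinate maps, like
   n.-tuple R in the library; for R : realType this is the Borel
   sigma-algebra of R^n. *)
Definition rV_coord (R : realType) (n : nat) (i : 'I_n) (v : 'rV[R]_n) : R :=
  v ord0 i.

Section measurable_rV.
Context (R : realType) (n : nat).

Let rV_measurable : set (set 'rV[R]_n) := g_sigma_preimage (@rV_coord R n).

Let rV_measurable0 : rV_measurable set0.
Proof. exact: sigma_algebra0. Qed.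

Let rV_measurableC A : rV_measurable A -> rV_measurable (~` A).
Proof. exact: sigma_algebraC. Qed.

Let rV_measurable_bigcup (F : (set 'rV[R]_n)^nat) :
  (forall i, rV_measurable (F i)) -> rV_measurable (\bigcup_i F i).
Proof. exact: sigma_algebra_bigcup. Qed.

HB.instance Definition _ :=
  @isMeasurable.Build (measure_tuple_display default_measure_display)
    'rV[R]_n rV_measurable rV_measurable0 rV_measurableC rV_measurable_bigcup.

End measurable_rV.

Lemma measurable_rV_coord (R : realType) (n : nat) (i : 'I_n) :
  measurable_fun [set: 'rV[R]_n] (rV_coord i).
Proof.
move=> _ Y mY; rewrite setTI; apply: sub_sigma_algebra => /=.
rewrite -bigcup_seq/=; exists i => /=; first by rewrite mem_index_enum.
by exists Y => //; rewrite setTI.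
Qed.

Lemma measurable_fun_rVP (R : realType) (n : nat) (dT : measure_display)
    (T : measurableType dT) (f : T -> 'rV[R]_n) :
  measurable_fun [set: T] f <->
  forall i, measurable_fun [set: T] (rV_coord i \o f).
Proof.
split=> [mf i|mf].
  by apply: measurableT_comp => //; exact: measurable_rV_coord.
move=> _ A mA; rewrite setTI.
have : g_sigma_preimage (fun i => @rV_coord R n i \o f) `<=` measurable.
  apply: smallest_sub; first exact: sigma_algebra_measurable.
  rewrite -bigcup_seq/=; apply: bigcup_sub => i _ _ [B mB <-].
  exact: mf.
apply; rewrite g_sigma_preimage_comp; exists A => //.
by rewrite setTI.
Qed.

(* Lebesgue measure on R^n: the n-fold product of [lebesgue_measure],
   transported along R * R^n ~ R^(n+1). *)
Definition rV_cons (R : realType) (n : nat)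
    (p : measurableTypeR R * 'rV[R]_n) : 'rV[R]_n.+1 :=
  row_mx (const_mx p.1 : 'rV[R]_1) p.2.

Lemma rV_cons0 (R : realType) (n : nat) (p : measurableTypeR R * 'rV[R]_n) :
  rV_coord ord0 (rV_cons p) = p.1.
Proof.
by rewrite /rV_coord mxE; case: splitP => j //=; rewrite mxE.
Qed.

Lemma rV_consS (R : realType) (n : nat) (i : 'I_n)
    (p : measurableTypeR R * 'rV[R]_n) :
  rV_coord (lift ord0 i) (rV_cons p) = rV_coord i p.2.
Proof.
rewrite /rV_coord mxE; case: splitP => j /=; first by rewrite ord1.
by rewrite !ord1 /bump => -[/ord_inj ->].
Qed.

Lemma measurable_rV_cons (R : realType) (n : nat) :
  measurable_fun setT (@rV_cons R n).
Proof.
apply/measurable_fun_rVP => i; case: (unliftP ord0 i) => [j|] ->.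
  rewrite (_ : _ \o _ = rV_coord j \o snd).
    by apply: measurableT_comp => //; exact: measurable_rV_coord.
  by apply/funext => p; rewrite /= rV_consS.
rewrite (_ : _ \o _ = fst); first exact: measurable_fst.
by apply/funext => p; rewrite /= rV_cons0.
Qed.

Section rV_lebesgue.
Context (R : realType).
Local Open Scope ereal_scope.

Definition lebesgue_cons (n : nat)
    (mu : {sigma_finite_measure set 'rV[R]_n -> \bar R}) :
    set 'rV[R]_n.+1 -> \bar R :=
  pushforward (lebesgue_measure \x mu) (@rV_cons R n).

Section instances.
Context (n : nat) (mu : {sigma_finite_measure set 'rV[R]_n -> \bar R}).

Let lebesgue_cons0 : lebesgue_cons mu set0 = 0.
Proof. by rewrite /lebesgue_cons /pushforward preimage_set0 measure0. Qed.

Let lebesgue_cons_ge0 A : 0 <= lebesgue_cons mu A.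
Proof. by rewrite /lebesgue_cons /pushforward. Qed.

Let lebesgue_cons_sigma_additive : semi_sigma_additive (lebesgue_cons mu).
Proof.
move=> F mF tF mUF; rewrite /lebesgue_cons /pushforward preimage_bigcup.
have mpre A : measurable A -> measurable (@rV_cons R n @^-1` A).
  by move=> mA; rewrite -[X in measurable X]setTI; exact: measurable_rV_cons.
apply: measure_semi_sigma_additive => //.
- by move=> i; exact: mpre.
- apply/trivIsetP => /= i j _ _ ij; rewrite -preimage_setI.
  by move/trivIsetP : tF => /(_ _ _ _ _ ij) ->//; rewrite preimage_set0.
- by rewrite -preimage_bigcup; exact: mpre.
Qed.

HB.instance Definition _ := isMeasure.Build _ _ _ (lebesgue_cons mu)
  lebesgue_cons0 lebesgue_cons_ge0 lebesgue_cons_sigma_additive.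

Let lebesgue_cons_sigma_finite : sigma_finite setT (lebesgue_cons mu).
Proof.
have /sigma_finiteP[F [TF ndF Foo]] :=
  sigma_finiteT (@lebesgue_measure R : {sigma_finite_measure set _ -> \bar R}).
have /sigma_finiteP[G [TG ndG Goo]] := sigma_finiteT mu.
pose tl (v : 'rV[R]_n.+1) : 'rV[R]_n := (\row_j rV_coord (lift ord0 j) v)%R.
have mtl : measurable_fun setT tl.
  apply/measurable_fun_rVP => i.
  rewrite (_ : _ \o _ = rV_coord (lift ord0 i)).
    exact: measurable_rV_coord.
  by apply/funext => v; rewrite /= [LHS]mxE.
have tlK p : tl (rV_cons p) = p.2.
  by apply/rowP => j; rewrite mxE rV_consS.
exists (fun k => rV_coord ord0 @^-1` F k `&` tl @^-1` G k).
  apply/esym; rewrite -subTset => v _.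
  have [i _ Fi] : (\bigcup_i F i) (rV_coord ord0 v) by rewrite -TF.
  have [j _ Gj] : (\bigcup_i G i) (tl v) by rewrite -TG.
  exists (maxn i j) => //; split => /=.
    by move: Fi; exact/subsetPset/ndF/leq_maxl.
  by move: Gj; exact/subsetPset/ndG/leq_maxr.
move=> k; have [mF Fk] := Foo k; have [mG Gk] := Goo k; split.
  apply: measurableI.
    by rewrite -[X in measurable X]setTI; exact: measurable_rV_coord.
  by rewrite -[X in measurable X]setTI; exact: mtl.
rewrite /lebesgue_cons /pushforward (_ : _ @^-1` _ = F k `*` G k); last first.
  by apply/seteqP; split => p /=; rewrite rV_cons0 tlK.
by rewrite product_measure1E// lte_mul_pinfty// ge0_fin_numE.
Qed.

HB.instance Definition _ := Measure_isSigmaFinite.Build _ _ _ (lebesgue_cons mu)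
  lebesgue_cons_sigma_finite.

End instances.

Fixpoint rV_lebesgue (n : nat) :
    {sigma_finite_measure set 'rV[R]_n -> \bar R} :=
  match n with
  | 0 => dirac (0 : 'rV[R]_0)%R
  | m.+1 => lebesgue_cons (rV_lebesgue m)
  end.

Lemma rV_lebesgue_box (n : nat) (A : 'I_n -> set R) :
  (forall i, measurable (A i)) ->
  rV_lebesgue n [set v | forall i, A i (rV_coord i v)] =
  \prod_(i < n) lebesgue_measure (A i : set (measurableTypeR R)).
Proof.
elim: n A => [|n IH] A mA /=.
  by rewrite big_ord0 diracE mem_set// => -[].
rewrite big_ord_recl -(IH (fun i => A (lift ord0 i)))//.
rewrite -(@product_measure1E _ _ (measurableTypeR R))//; [|exact: mA|]; last first.
  rewrite (_ : [set v | _] =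
    \bigcap_(i in [set: 'I_n]) (rV_coord i @^-1` A (lift ord0 i))).
    apply: fin_bigcap_measurable => // i _.
    by rewrite -[X in measurable X]setTI; exact: measurable_rV_coord.
  by apply/seteqP; split => v /= Av i; [move=> _|]; exact: Av.
rewrite /lebesgue_cons /pushforward; congr product_measure1; apply/seteqP; split => -[x v] /=.
  move=> Av; split=> [|i]; first by have := Av ord0; rewrite rV_cons0.
  by have := Av (lift ord0 i); rewrite rV_consS.
move=> [Ax Av] i; case: (unliftP ord0 i) => [j|] ->.
  by rewrite rV_consS; exact: Av.
by rewrite rV_cons0.
Qed.

End rV_lebesgue.

(* Not the library norm on 'rV[R]_n, which is the sup norm. *)
Definition enorm (R : realType) (n : nat) (v : 'rV[R]_n) : R :=
  Num.sqrt (\sum_(i < n) v ord0 i ^+ 2).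

Definition eball (R : realType) (n : nat) (r : R) : set 'rV[R]_n :=
  [set v | enorm v < r].

Section random_vectors.
Context (dT : measure_display) (T : measurableType dT) (R : realType).
Context (P : probability T R) (n : nat).
Local Open Scope ereal_scope.

Definition is_density (Y : T -> 'rV[R]_n) (f : 'rV[R]_n -> R) : Prop :=
  [/\ measurable_fun setT f, (forall x, (0 <= f x)%R) &
      forall A, measurable A ->
        pushforward P Y A = \int[rV_lebesgue R n]_(x in A) (f x)%:E].

Definition convex_ereal (phi : 'rV[R]_n -> \bar R) : Prop :=
  forall (x y : 'rV[R]_n) (t : R), (0 < t < 1)%R ->
    phi (t *: x + (1 - t) *: y)%R <= t%:E * phi x + (1 - t)%:E * phi y.

Definition log_concave (Y : T -> 'rV[R]_n) : Prop :=
  exists phi : 'rV[R]_n -> \bar R,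
    [/\ forall x, phi x != -oo, convex_ereal phi &
        is_density Y (fun x => fine (expeR (- phi x)))].

Definition independent (X Y : T -> 'rV[R]_n) : Prop :=
  forall A B : set 'rV[R]_n, measurable A -> measurable B ->
    P (X @^-1` A `&` Y @^-1` B) = P (X @^-1` A) * P (Y @^-1` B).

End random_vectors.

Section majorization.
Context (R : realType) (n : nat).
Local Open Scope ereal_scope.

(* For 0 < n and A of positive finite volume there is exactly one such r, so
   this is the centered open ball A^* of the same volume; it is empty if A is
   null or of infinite volume. *)
Definition set_rearrangement (A : set 'rV[R]_n) : set 'rV[R]_n :=
  \bigcup_(r in [set r | rV_lebesgue R n (eball r) = rV_lebesgue R n A])
    eball r.

(* The values are extended reals because f^*(0) = +oo if f is essentially
   unbounded. *)
Definition is_rearrangement (f : 'rV[R]_n -> R) (fs : 'rV[R]_n -> \bar R) :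
    Prop :=
  (forall x, 0 <= fs x) /\
  forall t : R, (0 < t)%R ->
    [set x | t%:E < fs x] = set_rearrangement [set x | (t < f x)%R].

(* A nonnegative function is determined by its sets {f^* > t}, t > 0, so at most
   one fs qualifies. *)
Definition rearrangement (f : 'rV[R]_n -> R) : 'rV[R]_n -> \bar R :=
  get (is_rearrangement f).

Definition majorized (f g : 'rV[R]_n -> R) : Prop :=
  forall r : R, (0 < r)%R ->
    \int[rV_lebesgue R n]_(x in eball r) rearrangement f x <=
    \int[rV_lebesgue R n]_(x in eball r) rearrangement g x.

(* The library has ln 0 = 0 and 0 `^ a = 0 for a != 0, so points where f
   vanishes contribute 0 to both integrals. *)
Definition renyi_entropy (a : R) (f : 'rV[R]_n -> R) : \bar R :=
  if a == 1%R then - \int[rV_lebesgue R n]_x (f x * ln (f x))%:E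
  else ((1 - a)^-1)%:E * lne (\int[rV_lebesgue R n]_x (f x `^ a)%:E).

End majorization.

(* Main.v *)
(* For densities f and g, f is majorized by g as soon as
   int (f - s)_+ <= int (g - s)_+ for all s >= 0, and int (f - s)_+ is the
   supremum over A of P (Y in A) - s |A| when Y has density f.  By
   Prekopa-Leindler, the density of X + W is log-concave, so the supremum for
   X + W is attained at a convex superlevel set K, and u x := P (x + W in K) is
   quasi-concave.  Let x0 be a near-maximizer of u: moving x towards x0 cannot
   decrease u by more than e, hence
   P (l X + (1 - l) x0 + W in K) >= P (X + W in K) - e,
   and K - (1 - l) x0 is a competitor of the same volume for l X + W.
   The entropies are monotone because f^a is a mixture over s of the functions
   (f - s)_+ (for a > 1) or min (f, s) (for a < 1), and similarly for f ln f. *)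
Require Import Defs.
From HB Require Import structures.
From mathcomp Require Import all_boot all_order all_algebra.
From mathcomp Require Import all_classical all_reals all_analysis.
From mathcomp Require Import measurable_realfun zify ring lra.
Set Implicit Arguments.
Unset Strict Implicit.
Unset Printing Implicit Defensive.
Import Order.TTheory GRing.Theory Num.Theory.
Import numFieldNormedType.Exports.

Local Open Scope classical_set_scope.
Local Open Scope ring_scope.

(** * Layer cake formula and affine changes of variables *)

(** Prekopa-Leindler is used only in a quasi-concave form: a level exceeded by the integrals of two
    sections is reached by the integral of the section between them. This avoids powers of infinite
    integrals, and it serves twice: for the convexity of the superlevel sets of the density of
    [X + W], and for the quasi-concavity of the probability that [x + W] lies in [K]. The error [e]
    replaces a compactness argument for a maximizer of that probability. A density is determined
    only up to null sets, and an arbitrary version need not have convex superlevel sets. The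
    argument is therefore run on the convolution integrals, and hinge integrals, which depend only
    on the law, carry the result to every version. A log-concave density is bounded. This makes the
    convolution finite at every point, and it also settles the Shannon entropy: the weight [1/s]
    that represents [y ln y] is not integrable at infinity against [min (y, s)], so it has to be cut
    off at a bound of the densities. *)

Section layer_cake.
Local Open Scope ereal_scope.
Context d (T : measurableType d) (R : realType).
Variable m : {sigma_finite_measure set T -> \bar R}.
Variable f : T -> \bar R.
Hypothesis mf : measurable_fun setT f.
Hypothesis f0 : forall x, 0 <= f x.

Let S : set (T * measurableTypeR R) :=
  [set q | (0 < (q.2 : R))%R && ((q.2 : R)%:E < f q.1)].
Let Sx x : set (measurableTypeR R) :=
  [set u | (0 < (u : R))%R && ((u : R)%:E < f x)].
Let k (p : T * measurableTypeR R) : \bar R := (\1_S p)%:E.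

Let mk : measurable_fun setT k.
Proof.
apply/measurable_EFinP; apply: measurable_indic.
rewrite -[X in measurable X]setTI.
have : measurable_fun setT (fun q : T * measurableTypeR R =>
    (0 < (q.2 : R))%R && ((q.2 : R)%:E < f q.1)).
  apply: measurable_and.
    by apply: measurable_fun_ltr => //; exact: measurable_snd.
  apply: measurable_fun_lte.
    by apply/measurable_EFinP; exact: measurable_snd.
  by apply: measurableT_comp => //; exact: measurable_fst.
by move=> /(_ measurableT [set true]); exact.
Qed.

Let k0 p : 0 <= k p.
Proof. by rewrite lee_fin. Qed.

Let inner1 x : \int[@lebesgue_measure R]_u k (x, u) = f x.
Proof.
have -> : (fun u : measurableTypeR R => k (x, u)) =
    (fun u => (\1_(Sx x) u)%:E) by [].
case E : (f x) (f0 x) => [r| |//] r0.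
- have -> : Sx x = `]0%R, r[%classic.
    by apply/seteqP; split => u /=; rewrite /Sx/= in_itv/= E lte_fin.
  rewrite integral_indic//= setIT lebesgue_measure_itv/= lte_fin.
  by move: r0; rewrite lee_fin le_eqVlt => /predU1P[<-|->]; rewrite ?ltxx// sube0.
- have -> : Sx x = `]0%R, +oo[%classic.
    by apply/seteqP; split => u /=; rewrite /Sx/= in_itv/= E ltry.
  by rewrite integral_indic//= setIT lebesgue_measure_itv/= ltry.
Qed.

Let inner2 (u : measurableTypeR R) : \int[m]_x k (x, u) =
  ((fun u : measurableTypeR R => m [set x | (u : R)%:E < f x]) \_ `]0%R, +oo[) u.
Proof.
rewrite patchE; case: ifPn.
  rewrite inE/= in_itv/= andbT => u0.
  rewrite -[X in m X](setIT) -integral_indic//; last first.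
    by rewrite -[X in measurable X]setTI; exact: emeasurable_fun_o_infty.
  by apply: eq_integral => x _; rewrite /k !indicE; congr (_%:R)%:E;
    congr nat_of_bool; apply/idP/idP; rewrite !inE /S/= u0.
rewrite notin_setE/= in_itv/= andbT => /negP u0.
by apply: integral0_eq => x _; rewrite /k indicE memNset// /S/= (negbTE u0).
Qed.

Lemma measurable_tail : measurable_fun (`]0%R, +oo[ : set (measurableTypeR R))
  (fun u : measurableTypeR R => m [set x | (u : R)%:E < f x]).
Proof.
apply/(measurable_restrictT _ (measurable_itv _)).
rewrite -(funext inner2).
exact: (measurable_fun_fubini_tonelli_G k).
Qed.

(** Both sides are iterated integrals of the indicator of [S], the region between 0 and the graph of
    [f], so Tonelli applies. The value [+oo] is allowed because rearrangements can take it. *)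
Lemma layer_cake : \int[m]_x f x =
  \int[@lebesgue_measure R]_(u in `]0%R, +oo[) m [set x | (u : R)%:E < f x].
Proof.
rewrite [RHS]integral_mkcond -(funext inner2) -(funext inner1).
by rewrite (fubini_tonelli k).
Qed.

End layer_cake.

(** Bundled as a measure, so that the characterization of Lebesgue measure by its values on
    intervals applies to it. *)
Definition mscale_pushforward d d' (T : measurableType d) (T' : measurableType d')
    (R : realType) (m : {measure set T -> \bar R}) (f : T -> T')
    (mf : measurable_fun setT f) (c : {nonneg R}) : {measure set T' -> \bar R} :=
  mscale c (measure_function_pushforward__canonical__measure_function_Measure m mf).

Section lebesgue_affine.
Context (R : realType).
Local Open Scope ereal_scope.
Notation leb := (@lebesgue_measure R).

Lemma measurable_affine (c a : R) :
  measurable_fun setT (fun x : measurableTypeR R => (c * x + a)%R : measurableTypeR R).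
Proof. by apply: measurable_funD => //; exact: measurable_funM. Qed.

(** The image of Lebesgue measure under the affine map, multiplied by [c], gives every half-open
    interval its length, hence is Lebesgue measure. *)
Lemma lebesgue_measure_affine (c a : R) (A : set (measurableTypeR R)) : (0 < c)%R ->
  measurable A -> leb ((fun x : R => c * x + a)%R @^-1` A) = (c^-1)%:E * leb A.
Proof.
move=> c0 mA.
have ci : (0 <= c^-1)%R by rewrite invr_ge0 ltW.
pose m1 := mscale_pushforward leb (measurable_affine c a) (NngNum (ltW c0)).
have : leb A = m1 A.
  apply: lebesgue_measure_unique => // X -[[x y]] /= _ <-.
  rewrite /m1 /mscale_pushforward /mscale/= /pushforward.
  rewrite (_ : (_ @^-1` _) = `](x - a) / c, (y - a) / c]%classic)%R; last first.
    apply/seteqP; split => z /=; rewrite !in_itv/= ltr_pdivrMr// ler_pdivlMr//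
      ltrBlDr lerBrDr mulrC//.
  rewrite !lebesgue_measure_itv/= !lte_fin ltr_pM2r ?invr_gt0// ltrD2r.
  case: ifPn => // _; last by rewrite mule0.
  rewrite -!EFinD -EFinM; congr EFin; field.
  by rewrite gt_eqF.
rewrite /m1 /mscale_pushforward /mscale/= /pushforward => ->.
by rewrite muleA -EFinM mulVf ?gt_eqF// mul1e.
Qed.

Lemma ge0_integral_affine (c a : R) (f : measurableTypeR R -> \bar R) : (0 < c)%R ->
  measurable_fun setT f -> (forall x, 0 <= f x) ->
  \int[leb]_x f (c * x + a)%R = (c^-1)%:E * \int[leb]_x f x.
Proof.
move=> c0 mf f0.
have ci : (0 <= c^-1)%R by rewrite invr_ge0 ltW.
have -> : \int[leb]_x f (c * x + a)%R =
    \int[pushforward leb (fun x : measurableTypeR R =>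
      (c * x + a)%R : measurableTypeR R)]_x f x.
  by rewrite (ge0_integral_pushforward (measurable_affine c a) _ measurableT)// preimage_setT.
rewrite -(ge0_integral_mscale leb measurableT (NngNum ci))//.
apply: eq_measure_integral => [|maff A mA _]; first exact: measurable_affine.
exact: lebesgue_measure_affine.
Qed.

End lebesgue_affine.

(** * Measurability, dilations and ball volumes in R^n *)

Section rV_measurability.
Context (R : realType).

Lemma measurable_rV_affine n (c : R) (a : 'rV[R]_n) :
  measurable_fun setT (fun v : 'rV[R]_n => c *: v + a).
Proof.
apply/measurable_fun_rVP => i.
rewrite (_ : _ \o _ = (fun v => c * rV_coord i v + rV_coord i a)); last first.
  by apply/funext => v; rewrite /rV_coord/= !mxE.
apply: measurable_funD => //; apply: measurable_funM => //.
exact: measurable_rV_coord.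
Qed.

Lemma measurable_rV_comb n (b c : R) :
  measurable_fun setT (fun p : 'rV[R]_n * 'rV[R]_n => b *: p.1 + c *: p.2).
Proof.
apply/measurable_fun_rVP => i.
rewrite (_ : _ \o _ = (fun p : 'rV[R]_n * 'rV[R]_n =>
    b * rV_coord i p.1 + c * rV_coord i p.2)); last first.
  by apply/funext => v; rewrite /rV_coord/= !mxE.
by apply: measurable_funD => //; apply: measurable_funM => //;
  (apply: measurableT_comp; [exact: measurable_rV_coord|]).
Qed.

Lemma measurable_enorm n : measurable_fun setT (@enorm R n).
Proof.
apply: measurableT_comp.
  by apply: continuous_measurable_fun; exact: sqrt_continuous.
apply: measurable_sum => i; apply: measurable_funX.
exact: measurable_rV_coord.
Qed.

Lemma measurable_eball n (r : R) : measurable (eball (n:=n) r).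
Proof.
rewrite -[X in measurable X]setTI.
have : measurable_fun setT (fun v : 'rV[R]_n => enorm v < r).
  by apply: measurable_fun_ltr => //; exact: measurable_enorm.
by move=> /(_ measurableT [set true]); exact.
Qed.

End rV_measurability.

Section rV_integral.
Context (R : realType).
Local Open Scope ereal_scope.
Notation leb := (@lebesgue_measure R).

Section cons.
Context n (f : 'rV[R]_n.+1 -> \bar R).
Hypothesis mf : measurable_fun setT f.
Hypothesis f0 : forall v, 0 <= f v.

Lemma measurable_fun_rV_cons (x : measurableTypeR R) :
  measurable_fun setT (fun v => f (rV_cons (x, v))).
Proof.
apply: measurableT_comp => //.
apply: measurableT_comp; first exact: measurable_rV_cons.
exact: pair1_measurable.
Qed.

Lemma measurable_integral_rV_cons : measurable_fun setT
  (fun x : measurableTypeR R => \int[rV_lebesgue R n]_v f (rV_cons (x, v))).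
Proof.
apply: (measurable_fun_fubini_tonelli_F (m2 := rV_lebesgue R n)
  (f \o @rV_cons R n)) => [|p]; last exact: f0.
by apply: measurableT_comp => //; exact: measurable_rV_cons.
Qed.

Lemma ge0_integral_rV_cons : \int[rV_lebesgue R n.+1]_v f v =
  \int[leb]_x \int[rV_lebesgue R n]_v f (rV_cons (x, v)).
Proof.
have mc : measurable_fun setT (f \o @rV_cons R n).
  by apply: measurableT_comp => //; exact: measurable_rV_cons.
rewrite -(fubini_tonelli1 (f \o @rV_cons R n))//.
rewrite -(ge0_integral_pushforward (@measurable_rV_cons R n) _ measurableT)//.
by move=> p; exact: f0.
Qed.

End cons.

(** Induction on [n] through Tonelli: the map acts separately on the first coordinate and on the
    remaining ones, and each coordinate contributes one factor [c^-1]. *)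
Lemma ge0_integral_rV_affine n (c : R) (a : 'rV[R]_n) (f : 'rV[R]_n -> \bar R) :
  (0 < c)%R -> measurable_fun setT f -> (forall v, 0 <= f v) ->
  \int[rV_lebesgue R n]_v f (c *: v + a)%R =
  (c^-1 ^+ n)%:E * \int[rV_lebesgue R n]_v f v.
Proof.
move=> c0; elim: n a f => [|n IH] a f mf f0.
  rewrite expr0 mul1e; apply: eq_integral => v _.
  by congr f; rewrite [LHS]thinmx0 [RHS]thinmx0.
have mfa : measurable_fun setT (fun v : 'rV[R]_n.+1 => f (c *: v + a)%R).
  by apply: measurableT_comp => //; exact: measurable_rV_affine.
rewrite (ge0_integral_rV_cons mf)// (ge0_integral_rV_cons mfa)//.
pose a' : 'rV[R]_n := (\row_j a ord0 (lift ord0 j))%R.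
have cE x v : (c *: rV_cons (x, v) + a)%R =
    rV_cons ((c * (x : R) + a ord0 ord0)%R : measurableTypeR R, (c *: v + a')%R).
  apply/rowP => j; case: (unliftP ord0 j) => [k|] ->.
    have /= := rV_consS k ((c * (x : R) + a ord0 ord0)%R : measurableTypeR R, (c *: v + a')%R).
    have /= := rV_consS k (x, v).
    by rewrite /rV_coord !mxE => -> ->.
  have /= := rV_cons0 ((c * (x : R) + a ord0 ord0)%R : measurableTypeR R, (c *: v + a')%R).
  have /= := rV_cons0 (x, v).
  by rewrite /rV_coord !mxE => -> ->.
under eq_integral => x _.
  under eq_integral => v _ do rewrite cE.
  rewrite (IH a' (fun v => f (rV_cons
    ((c * (x : R) + a ord0 ord0)%R : measurableTypeR R, v))))//; last first.
    exact: measurable_fun_rV_cons.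
  over.
rewrite ge0_integralZl//; last 3 first.
- exact: (measurableT_comp (measurable_integral_rV_cons mf f0)
    (measurable_affine c (a ord0 ord0))).
- by move=> x _; apply: integral_ge0.
- by rewrite lee_fin exprn_ge0// invr_ge0 ltW.
rewrite (ge0_integral_affine (a ord0 ord0) c0
  (f := fun x => \int[rV_lebesgue R n]_v f (rV_cons (x, v)))).
- by rewrite muleA -EFinM exprSr.
- exact: measurable_integral_rV_cons.
- by move=> x; apply: integral_ge0.
Qed.

Lemma rV_lebesgue_affine n (c : R) (a : 'rV[R]_n) (A : set 'rV[R]_n) :
  (0 < c)%R -> measurable A ->
  rV_lebesgue R n [set v | A (c *: v + a)%R] =
  (c^-1 ^+ n)%:E * rV_lebesgue R n A.
Proof.
move=> c0 mA.
have mAa : measurable [set v : 'rV[R]_n | A (c *: v + a)%R].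
  by rewrite -[X in measurable X]setTI; exact: measurable_rV_affine.
rewrite -[in LHS](setIT [set v | _]) -[in RHS](setIT A) -!integral_indic//.
rewrite -(ge0_integral_rV_affine a c0)//.
by apply/measurable_EFinP; exact: measurable_indic.
Qed.

Lemma rV_lebesgue_box_itv n (a b : R) : (a <= b)%R ->
  rV_lebesgue R n [set v | forall i, `]a, b[%classic (rV_coord i v)] =
  ((b - a) ^+ n)%:E.
Proof.
move=> ab; rewrite (@rV_lebesgue_box _ _ (fun=> `]a, b[%classic)).
  rewrite (eq_bigr (fun=> (b - a)%:E)) => [|i _].
    by rewrite prodEFin big_const card_ord iter_mulr_1.
  rewrite lebesgue_measure_itv/= lte_fin; case: ltP => // ba.
  by rewrite (_ : b = a) ?subrr//; apply/eqP; rewrite eq_le ab ba.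
by move=> i; exact: measurable_itv.
Qed.

Lemma enormZ n (c : R) (v : 'rV[R]_n) : (0 <= c)%R ->
  enorm (c *: v) = (c * enorm v)%R.
Proof.
move=> c0; rewrite /enorm; under eq_bigr do rewrite mxE exprMn.
by rewrite -mulr_sumr sqrtrM ?sqr_ge0// sqrtr_sqr ger0_norm.
Qed.

Lemma eball_affine n (r : R) : (0 < r)%R ->
  eball r = [set v : 'rV[R]_n | eball 1 (r^-1 *: v + 0)%R].
Proof.
move=> r0; apply/seteqP; split => v; rewrite /eball/= addr0 enormZ ?invr_ge0 ?ltW//;
  by rewrite mulrC ltr_pdivrMr// mul1r.
Qed.

Lemma rV_lebesgue_eball n (r : R) : (0 < r)%R ->
  rV_lebesgue R n (eball r) = (r ^+ n)%:E * rV_lebesgue R n (eball 1).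
Proof.
move=> r0; rewrite eball_affine// rV_lebesgue_affine ?invr_gt0//.
  by rewrite invrK.
exact: measurable_eball.
Qed.

Lemma measurable_box n (a b : R) :
  measurable [set v : 'rV[R]_n | forall i, `]a, b[%classic (rV_coord i v)].
Proof.
rewrite (_ : [set v | _] =
  \bigcap_(i in [set: 'I_n]) (@rV_coord R n i @^-1` `]a, b[%classic)).
  apply: fin_bigcap_measurable => // i _.
  by rewrite -[X in measurable X]setTI; exact: measurable_rV_coord.
by apply/seteqP; split => v /= Av i; [move=> _|]; exact: Av.
Qed.

Lemma le_coord_enorm n (v : 'rV[R]_n) i : (`|v ord0 i| <= enorm v)%R.
Proof.
rewrite /enorm -sqrtr_sqr ler_wsqrtr// (bigD1 i)//= lerDl.
by apply: sumr_ge0 => j _; rewrite sqr_ge0.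
Qed.

Lemma rV_lebesgue_eball1_lty n : rV_lebesgue R n (eball 1) < +oo.
Proof.
apply: (@le_lt_trans _ _ (rV_lebesgue R n
  [set v | forall i, `](- 1)%R, 1%R[%classic (rV_coord i v)])); last first.
  by rewrite rV_lebesgue_box_itv ?ltry// lerN10.
apply: le_measure; rewrite ?inE; [exact: measurable_eball|exact: measurable_box|].
move=> v /= v1 i; rewrite /rV_coord in_itv/= -ltr_norml.
exact: le_lt_trans (le_coord_enorm _ _) v1.
Qed.

Lemma rV_lebesgue_eball1_gt0 n : 0 < rV_lebesgue R n (eball 1).
Proof.
(* The cube of half-side [e] fits into the unit ball because n / (n+1)^2 < 1; taking n+1 also covers
   [n = 0]. *)
pose e : R := (n.+1%:R^-1)%R.
have e0 : (0 < e)%R by rewrite invr_gt0 ltr0n.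
apply: (@lt_le_trans _ _ (rV_lebesgue R n
  [set v | forall i, `](- e)%R, e[%classic (rV_coord i v)])).
  by rewrite rV_lebesgue_box_itv ?lte_fin ?exprn_gt0//; lra.
apply: le_measure; rewrite ?inE; [exact: measurable_box|exact: measurable_eball|].
move=> v /= ve; rewrite /eball/= /enorm -[ltRHS]sqrtr1 ltr_sqrt//.
apply: (@le_lt_trans _ _ (\sum_(i < n) e ^+ 2)%R).
  apply: ler_sum => i _; rewrite -[leLHS]real_normK ?num_real// ler_sqr ?nnegrE ?(ltW e0)//.
  by have := ve i; rewrite in_itv/= -ltr_norml => /ltW.
rewrite sumr_const card_ord -mulr_natl /e exprVn -/(_ / _)%R ltr_pdivrMr ?exprn_gt0 ?ltr0n//.
by rewrite mul1r -natrX ltr_nat; nia.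
Qed.

End rV_integral.

(** * The Prekopa-Leindler inequality *)

Section brunn_minkowski1.
Context (R : realType).
Local Open Scope ereal_scope.
Notation leb := (@lebesgue_measure R).

(* Translates of A and B inside A + B can be chosen to overlap in an
   arbitrarily short interval, around sup A + inf B. *)
Lemma lebesgue_measure_sumset (A B C : set (measurableTypeR R)) (N : R) :
  measurable A -> measurable B -> measurable C -> A !=set0 -> B !=set0 ->
  (forall x : R, A x -> `|x| <= N)%R -> (forall x : R, B x -> `|x| <= N)%R ->
  (forall x y : R, A x -> B y -> C (x + y)%R) ->
  leb A + leb B <= leb C.
Proof.
move=> mA mB mC A0 B0 AN BN ABC.
have supA : has_sup (A : set R).
  by split => //; exists N => x /AN; rewrite ler_norml => /andP[].
have infB : has_inf (B : set R).
  by split => //; exists (- N)%R => x /BN; rewrite ler_norml => /andP[].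
apply/lee_addgt0Pr => e e0.
have e20 : (0 < e / 2)%R by rewrite divr_gt0.
have [a' Aa' aa'] := sup_adherent e20 supA.
have [b' Bb' bb'] := inf_adherent e20 infB.
pose S1 : set (measurableTypeR R) := [set z | A (1 * z + - b')%R].
pose S2 : set (measurableTypeR R) := [set z | B (1 * z + - a')%R].
have mS1 : measurable S1.
  by rewrite -[X in measurable X]setTI; exact: measurable_affine.
have mS2 : measurable S2.
  by rewrite -[X in measurable X]setTI; exact: measurable_affine.
have lS1 : leb A = leb S1.
  by have /= -> := lebesgue_measure_affine (- b') ltr01 mA; rewrite invr1 mul1e.
have lS2 : leb B = leb S2.
  by have /= -> := lebesgue_measure_affine (- a') ltr01 mB; rewrite invr1 mul1e.
(* Both translates lie in [C], so [C] pays for [S2] together with the part of [S1] outside it; only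
   the overlap of [S1] and [S2] remains to be bounded by [e]. *)
rewrite lS1 lS2 (measureDI _ mS1 mS2).
rewrite addeAC; apply: leeD.
  rewrite -measureU//; last 2 first.
  - exact: measurableD.
  - by rewrite setDKI.
  apply: le_measure; rewrite ?inE//.
    by apply: measurableU => //; exact: measurableD.
  move=> z [[]|]; rewrite /S1 /S2/= mul1r.
    by move=> Az _; rewrite -(subrK b' z); exact: ABC.
  by move=> Bz; rewrite -(subrK a' z) addrC; exact: ABC.
(* The overlap lies in an interval of length (sup A - a') + (b' - inf B), and each term is below
   [e / 2]. *)
have -> : e = ((sup (A : set R) + b') - (a' + inf (B : set R)) +
  (e - ((sup (A : set R) + b') - (a' + inf (B : set R)))))%R by ring.
apply: (@le_trans _ _ (leb `[(a' + inf (B : set R))%R, (sup (A : set R) + b')%R]%classic)).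
  apply: le_measure;
    [by rewrite inE; exact: measurableI|by rewrite inE; exact: measurable_itv|].
  move=> z []; rewrite /S1 /S2/= mul1r in_itv/= => /(ub_le_sup supA.2).
  by rewrite lerBlDr => -> /(ge_inf infB.2); rewrite lerBrDl => ->.
rewrite lebesgue_measure_itv/= lte_fin; case: ifPn => _.
  by rewrite -EFinD lee_fin lerDl; lra.
by rewrite lee_fin; lra.
Qed.

(** The sumset bound applied to the dilates of [A] by [t] and of [B] by [1 - t]; these are still
    bounded by [N] because both factors are below 1. *)
Lemma lebesgue_measure_convex_comb (A B C : set (measurableTypeR R)) (N t : R) :
  (0 < t < 1)%R ->
  measurable A -> measurable B -> measurable C -> A !=set0 -> B !=set0 ->
  (forall x : R, A x -> `|x| <= N)%R -> (forall x : R, B x -> `|x| <= N)%R ->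
  (forall x y : R, A x -> B y -> C (t * x + (1 - t) * y)%R) ->
  t%:E * leb A + (1 - t)%:E * leb B <= leb C.
Proof.
move=> /andP[t0 t1] mA mB mC [a Aa] [b Bb] AN BN ABC.
have t1' : (0 < 1 - t)%R by lra.
have sc (c : R) (D : set (measurableTypeR R)) : (0 < c)%R -> measurable D ->
  c%:E * leb D = leb [set z : measurableTypeR R | D (c^-1 * z + 0)%R].
  move=> c0 mD; have ci : (0 < c^-1)%R by rewrite invr_gt0.
  by have /= -> := lebesgue_measure_affine 0%R ci mD; rewrite invrK.
have msc (c : R) (D : set (measurableTypeR R)) : measurable D ->
  measurable [set z : measurableTypeR R | D (c^-1 * z + 0)%R].
  by move=> mD; rewrite -[X in measurable X]setTI; exact: measurable_affine.
have bsc (c : R) (D : set (measurableTypeR R)) : (0 < c < 1)%R ->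
    (forall x : R, D x -> `|x| <= N)%R -> forall x : R, D (c^-1 * x + 0)%R -> (`|x| <= N)%R.
  move=> /andP[c0 c1] DN x /DN; rewrite addr0 normrM gtr0_norm ?invr_gt0//.
  rewrite ler_pdivrMl// => xN; have x0 := normr_ge0 x.
  have N0 : (0 <= N)%R by rewrite -(pmulr_rge0 N c0) (le_trans x0).
  by apply: le_trans xN _; nra.
rewrite !sc//; apply: (@lebesgue_measure_sumset _ _ _ N) => //; rewrite ?msc//.
- exact: msc.
- exact: msc.
- by exists (t * a)%R; rewrite /= mulKf ?gt_eqF// addr0.
- by exists ((1 - t) * b)%R; rewrite /= mulKf ?gt_eqF// addr0.
- by apply: bsc => //; rewrite t0.
- by apply: bsc => //; rewrite t1'/=; lra.
- move=> x y /=; rewrite !addr0 => Ax By.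
  by have := ABC _ _ Ax By; rewrite !mulVKf ?gt_eqF.
Qed.

End brunn_minkowski1.

Section prekopa_leindler1.
Context (R : realType).
Local Open Scope ereal_scope.
Notation leb := (@lebesgue_measure R).
Variables (t N : R).
Hypothesis t01 : (0 < t < 1)%R.

Let t0 : (0 < t)%R. Proof. by case/andP : t01. Qed.
Let t1 : (0 < 1 - t)%R. Proof. by case/andP : t01 => _; rewrite subr_gt0. Qed.

(** With both suprema equal to 1, the superlevel sets of [f] and [g] at a positive level are
    nonempty exactly below level 1. Brunn-Minkowski then applies level by level, and the layer cake
    formula integrates it. This yields the arithmetic mean of the integrals, which is stronger than
    the geometric one. *)
Lemma prekopa_leindler1_normalized (f g : measurableTypeR R -> R)
    (h : measurableTypeR R -> \bar R) :
  measurable_fun setT f -> measurable_fun setT g -> measurable_fun setT h ->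
  (forall x, 0 <= f x <= 1)%R -> (forall x, 0 <= g x <= 1)%R ->
  (forall x, 0 <= h x) ->
  (forall s : R, s < 1 -> exists x, s < f x)%R ->
  (forall s : R, s < 1 -> exists x, s < g x)%R ->
  (forall x : R, N < `|x| -> f x = 0)%R ->
  (forall x : R, N < `|x| -> g x = 0)%R ->
  (forall (x y s : R), (0 < s)%R -> (s < f x)%R -> (s < g y)%R ->
    s%:E < h (t * x + (1 - t) * y)%R) ->
  t%:E * \int[leb]_x (f x)%:E + (1 - t)%:E * \int[leb]_x (g x)%:E
    <= \int[leb]_x h x.
Proof.
move=> mf mg mh f01 g01 h0 supf supg fN gN fgh.
have mf' : measurable_fun setT (EFin \o f) by exact/measurable_EFinP.
have mg' : measurable_fun setT (EFin \o g) by exact/measurable_EFinP.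
have f0 x : 0 <= (EFin \o f) x by rewrite lee_fin; case/andP : (f01 x).
have g0 x : 0 <= (EFin \o g) x by rewrite lee_fin; case/andP : (g01 x).
have t0' := ltW t0. have t1' := ltW t1.
rewrite (layer_cake leb mf')// (layer_cake leb mg')// (layer_cake leb mh)//.
have mtf := measurable_tail leb mf'.
have mtg := measurable_tail leb mg'.
have mth := measurable_tail leb mh.
have mtop (k : measurableTypeR R -> \bar R) u : measurable_fun setT k ->
    measurable [set x | u < k x].
  by move=> mk; rewrite -[X in measurable X]setTI; exact: emeasurable_fun_o_infty.
rewrite -!ge0_integralZl//.
rewrite -ge0_integralD//; last 4 first.
- by move=> u _; rewrite mule_ge0.
- exact: measurable_funeM.
- by move=> u _; rewrite mule_ge0.
- exact: measurable_funeM.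
apply: ge0_le_integral => //.
- by move=> u _; rewrite adde_ge0// mule_ge0.
- by apply: emeasurable_funD; exact: measurable_funeM.
move=> u; rewrite /= in_itv/= andbT => u0.
have [u1|u1] := ltP u 1%R.
  have [a fa] := supf _ u1.
  have [b gb] := supg _ u1.
  apply: (@lebesgue_measure_convex_comb _ _ _ _ N) => //=.
  - exact: mtop.
  - exact: mtop.
  - exact: mtop.
  - by exists a; rewrite /= lte_fin.
  - by exists b; rewrite /= lte_fin.
  - by move=> x; apply: contraPP => /negP; rewrite -ltNge => /fN ->;
    rewrite lte_fin; apply/negP; rewrite -leNgt ltW.
  - by move=> x; apply: contraPP => /negP; rewrite -ltNge => /gN ->;
    rewrite lte_fin; apply/negP; rewrite -leNgt ltW.
  - by move=> x y; rewrite !lte_fin; exact: fgh.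
rewrite (_ : [set x | _] = set0); last first.
  apply/seteqP; split => x //=; rewrite lte_fin => /(le_lt_trans u1).
  by case/andP : (f01 x) => _; rewrite ltNge => ->.
rewrite (_ : [set x | u%:E < (g x)%:E] = set0); last first.
  apply/seteqP; split => x //=; rewrite lte_fin => /(le_lt_trans u1).
  by case/andP : (g01 x) => _; rewrite ltNge => ->.
by rewrite !measure0 !mule0 adde0.
Qed.

(** Young's inequality for the conjugate exponents [t^-1] and [(1 - t)^-1]. *)
Lemma powR_le_convex_comb (a b : R) : (0 <= a)%R -> (0 <= b)%R ->
  (a `^ t * b `^ (1 - t) <= t * a + (1 - t) * b)%R.
Proof.
move=> a0 b0.
have /= := @conjugate_powR _ (a `^ t)%R (b `^ (1 - t))%R t^-1%R (1 - t)^-1%R.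
rewrite !powR_ge0 !invr_gt0 t0 t1 !invrK addrC subrK -!powRrM !mulfV ?gt_eqF//.
by rewrite !powRr1// (mulrC t a) (mulrC (1 - t)%R b); apply.
Qed.

(** Dividing [f] and [g] by their suprema [A] and [B], and [h] by the matching geometric mean [D],
    reduces to the normalized case; the arithmetic-geometric mean inequality then returns to the
    multiplicative form. Bounded height and support keep the integrals finite, so [fine] loses
    nothing. *)
Lemma prekopa_leindler1 (f g : measurableTypeR R -> R)
    (h : measurableTypeR R -> \bar R) (M : R) :
  measurable_fun setT f -> measurable_fun setT g -> measurable_fun setT h ->
  (forall x, 0 <= f x <= M)%R -> (forall x, 0 <= g x <= M)%R ->
  (forall x, 0 <= h x) ->
  (forall x : R, N < `|x| -> f x = 0)%R ->
  (forall x : R, N < `|x| -> g x = 0)%R ->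
  (forall (x y : R),
    (f x `^ t * g y `^ (1 - t))%:E <= h (t * x + (1 - t) * y)%R) ->
  ((fine (\int[leb]_x (f x)%:E)) `^ t * (fine (\int[leb]_x (g x)%:E)) `^ (1 - t))%:E
    <= \int[leb]_x h x.
Proof.
move=> mf mg mh f0M g0M h0 fN gN fgh.
have h0' : 0 <= \int[leb]_x h x by apply: integral_ge0.
have tn0 : t != 0%R by rewrite gt_eqF.
have t1n0 : (1 - t)%R != 0%R by rewrite gt_eqF.
have [[x0 fx0]|] := pselect (exists x, 0 < f x)%R; last first.
  move=> nf; rewrite integral0_eq ?powR0 ?mul0r// => x _.
  congr EFin; apply/eqP; rewrite eq_le; case/andP : (f0M x) => -> _; rewrite andbT.
  by rewrite leNgt; apply/negP => fx; apply: nf; exists x.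
have [[y0 gy0]|] := pselect (exists x, 0 < g x)%R; last first.
  move=> nf; rewrite (_ : \int[leb]_x (g x)%:E = 0) ?powR0 ?mulr0//; apply: integral0_eq => x _.
  congr EFin; apply/eqP; rewrite eq_le; case/andP : (g0M x) => -> _; rewrite andbT.
  by rewrite leNgt; apply/negP => fx; apply: nf; exists x.
have sf : has_sup (range (f : R -> R)).
  split; first by exists (f x0), x0.
  by exists M => _ [x _ <-]; case/andP : (f0M x).
have sg : has_sup (range (g : R -> R)).
  split; first by exists (g y0), y0.
  by exists M => _ [x _ <-]; case/andP : (g0M x).
set A := sup (range (f : R -> R)). set B := sup (range (g : R -> R)).
have fA x : (f x <= A)%R by apply: (ub_le_sup sf.2); exists x.
have gB x : (g x <= B)%R by apply: (ub_le_sup sg.2); exists x.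
have A0 : (0 < A)%R by exact: lt_le_trans (fA x0).
have B0 : (0 < B)%R by exact: lt_le_trans (gB y0).
pose D := (A `^ t * B `^ (1 - t))%R.
have D0 : (0 < D)%R by rewrite mulr_gt0// powR_gt0.
have Di : (0 <= D^-1)%R by rewrite invr_ge0 ltW.
have intZ (k : measurableTypeR R -> R) (c : R) : measurable_fun setT k ->
    (forall x, 0 <= k x)%R -> (0 < c)%R ->
    \int[leb]_x (k x)%:E = c%:E * \int[leb]_x (k x / c)%:E.
  move=> mk k0 c0; rewrite -ge0_integralZl//; last 3 first.
  - apply/measurable_EFinP; exact: measurable_funM.
  - by move=> x _; rewrite lee_fin divr_ge0// ltW.
  - by rewrite lee_fin ltW.
  apply: eq_integral => x _; rewrite -EFinM; congr EFin; field.
  by rewrite gt_eqF.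
have f0 x : (0 <= f x)%R by case/andP : (f0M x).
have g0 x : (0 <= g x)%R by case/andP : (g0M x).
rewrite (intZ f A)// (intZ g B)//.
have -> : \int[leb]_x h x = D%:E * \int[leb]_x (D^-1%:E * h x).
  rewrite -ge0_integralZl//; last 3 first.
  - exact: measurable_funeM.
  - by move=> x _; rewrite mule_ge0.
  - by rewrite lee_fin ltW.
  by apply: eq_integral => x _; rewrite muleA -EFinM mulfV ?gt_eqF// mul1e.
have f'1 x : (0 <= f x / A <= 1)%R.
  by rewrite divr_ge0 ?(ltW A0)// ler_pdivrMr// mul1r fA.
have g'1 x : (0 <= g x / B <= 1)%R.
  by rewrite divr_ge0 ?(ltW B0)// ler_pdivrMr// mul1r gB.
have fin (k : measurableTypeR R -> R) : measurable_fun setT k -> (forall x, 0 <= k x <= 1)%R ->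
    (forall x : R, N < `|x| -> k x = 0)%R -> \int[leb]_x (k x)%:E \is a fin_num.
  move=> mk k01 kN; rewrite ge0_fin_numE; last first.
    by apply: integral_ge0 => x _; rewrite lee_fin; case/andP : (k01 x).
  apply: (@le_lt_trans _ _ (\int[leb]_x
    (\1_(`[(- N)%R, N]%classic : set (measurableTypeR R)) x)%:E)).
    apply: ge0_le_integral => //.
    - by move=> x _; rewrite lee_fin; case/andP : (k01 x).
    - exact/measurable_EFinP.
    - by apply/measurable_EFinP; apply: measurable_indic; exact: measurable_itv.
    - move=> x _; have [xN|/kN ->] := leP `|x|%R N; last by rewrite lee_fin.
      rewrite lee_fin indicE mem_set; first by case/andP : (k01 x).
      by rewrite /= in_itv/= -ler_norml.
  rewrite integral_indic//=.
  rewrite setIT lebesgue_measure_itv/= lte_fin; case: ifPn => _; last exact: ltry.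
  by rewrite -EFinD ltry.
have f'N (x : R) : (N < `|x|)%R -> (f x / A = 0)%R by move=> /fN ->; rewrite mul0r.
have g'N (x : R) : (N < `|x|)%R -> (g x / B = 0)%R by move=> /gN ->; rewrite mul0r.
have mf' : measurable_fun setT (fun x => f x / A)%R by exact: measurable_funM.
have mg' : measurable_fun setT (fun x => g x / B)%R by exact: measurable_funM.
have finf := fin _ mf' f'1 f'N.
have fing := fin _ mg' g'1 g'N.
have If0 : (0 <= fine (\int[leb]_x (f x / A)%:E))%R.
  by apply: fine_ge0; apply: integral_ge0 => x _; rewrite lee_fin; case/andP : (f'1 x).
have Ig0 : (0 <= fine (\int[leb]_x (g x / B)%:E))%R.
  by apply: fine_ge0; apply: integral_ge0 => x _; rewrite lee_fin; case/andP : (g'1 x).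
rewrite !fineM// (powRM _ (ltW A0) If0) (powRM _ (ltW B0) Ig0).
rewrite mulrACA EFinM lee_pmul2l//.
apply: (@le_trans _ _ (t%:E * \int[leb]_x (f x / A)%:E + (1 - t)%:E * \int[leb]_x (g x / B)%:E)).
  rewrite -(fineK finf) -(fineK fing) -!EFinM -EFinD lee_fin.
  exact: powR_le_convex_comb.
apply: prekopa_leindler1_normalized => //.
- exact: measurable_funeM.
- by move=> x; rewrite mule_ge0.
(* The gap [A * (1 - s)] below the supremum is the one that gives a point where [f / A] exceeds
   [s]. *)
- move=> s s1; have e0 : (0 < A * (1 - s))%R by rewrite mulr_gt0// subr_gt0.
  have [_ [x _ <-] xA] := sup_adherent e0 sf.
  by exists x; rewrite ltr_pdivlMr//; move: xA; rewrite -/A; nra.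
- move=> s s1; have e0 : (0 < B * (1 - s))%R by rewrite mulr_gt0// subr_gt0.
  have [_ [x _ <-] xA] := sup_adherent e0 sg.
  by exists x; rewrite ltr_pdivlMr//; move: xA; rewrite -/B; nra.
- move=> x y s s0; rewrite !ltr_pdivlMr// => sf' sg'.
  rewrite (_ : s = D^-1 * (D * s))%R; last by rewrite mulKf ?gt_eqF.
  rewrite EFinM lte_pmul2l ?lte_fin ?invr_gt0//.
  apply: lt_le_trans (fgh x y); rewrite lte_fin.
  have -> : (D * s = (s * A) `^ t * (s * B) `^ (1 - t))%R.
    rewrite !powRM ?(ltW s0) ?(ltW A0) ?(ltW B0)// mulrACA -powRD; last first.
      by rewrite (gt_eqF s0) implybT.
    by rewrite addrC subrK powRr1 ?(ltW s0)// mulrC.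
  by rewrite ltr_pM ?powR_ge0// gt0_ltr_powR// nnegrE ?mulr_ge0// ltW.
Qed.

End prekopa_leindler1.

(** * Prekopa-Leindler in dimension n *)

Section prekopa_leindler.
Context (R : realType).
Local Open Scope ereal_scope.
Notation leb := (@lebesgue_measure R).
Variable t : R.
Hypothesis t01 : (0 < t < 1)%R.

Let tn0 : t != 0%R. Proof. by case/andP : t01 => t0 _; rewrite gt_eqF. Qed.
Let t1n0 : (1 - t)%R != 0%R.
Proof. by case/andP : t01 => _ t1; rewrite gt_eqF// subr_gt0. Qed.

Lemma rV_cons_comb n (a b : R) (x y : measurableTypeR R) (v w : 'rV[R]_n) :
  (a *: rV_cons (x, v) + b *: rV_cons (y, w))%R =
  rV_cons ((a * (x : R) + b * (y : R))%R : measurableTypeR R, (a *: v + b *: w)%R).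
Proof.
set z : measurableTypeR R := (_ + _)%R.
apply/rowP => j; case: (unliftP ord0 j) => [k|] ->.
  have /= := rV_consS k (z, (a *: v + b *: w)%R).
  have /= := rV_consS k (x, v); have /= := rV_consS k (y, w).
  by rewrite /rV_coord !mxE => -> -> ->.
have /= := rV_cons0 (z, (a *: v + b *: w)%R).
have /= := rV_cons0 (x, v); have /= := rV_cons0 (y, w).
by rewrite /rV_coord !mxE => -> -> ->.
Qed.

(** The half-side [|N| + 1] is positive whatever the sign of [N], and the open cube with that
    half-side contains every point where [k] can be nonzero. *)
Lemma le_integral_box n (k : 'rV[R]_n -> R) (M N : R) :
  measurable_fun setT k -> (forall v, 0 <= k v <= M)%R ->
  (forall (v : 'rV[R]_n) i, N < `|v ord0 i| -> k v = 0)%R ->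
  \int[rV_lebesgue R n]_v (k v)%:E <= (M * ((`|N| + 1) *+ 2) ^+ n)%:E.
Proof.
move=> mk kM kN; set N' := (`|N| + 1)%R.
have N'0 : (0 < N')%R by rewrite ltr_wpDl.
have M0 : (0 <= M)%R by have /andP[] := kM 0%R; exact: le_trans.
pose B := [set v : 'rV[R]_n | forall i, `](- N')%R, N'[%classic (rV_coord i v)].
have mB : measurable B by exact: measurable_box.
apply: (@le_trans _ _ (\int[rV_lebesgue R n]_v (M%:E * (\1_B v)%:E))).
  apply: ge0_le_integral => //.
  - by move=> v _; rewrite lee_fin; case/andP : (kM v).
  - exact/measurable_EFinP.
  - by apply: measurable_funeM; apply/measurable_EFinP; exact: measurable_indic.
  - move=> v _; have [Bv|Bv] := pselect (B v).
      by rewrite indicE mem_set// mule1 lee_fin; case/andP : (kM v).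
    have [i iB] : exists i, ~ (`](- N')%R, N'[%classic (rV_coord i v)).
      by apply/existsNP.
    rewrite (kN v i) ?mule_ge0 ?lee_fin//.
    move: iB; rewrite /= in_itv/= -ltr_norml => /negP; rewrite -leNgt.
    by apply: lt_le_trans; rewrite /N' ltr_pwDr// ler_norm.
have IB : \int[rV_lebesgue R n]_v (\1_B v)%:E = ((N' *+ 2) ^+ n)%:E.
  rewrite integral_indic//= setIT /B rV_lebesgue_box_itv; last by lra.
  by rewrite opprK mulr2n.
rewrite ge0_integralZl ?lee_fin//.
  by rewrite IB -EFinM.
by apply/measurable_EFinP; exact: measurable_indic.
Qed.

(** Induction on [n]: for fixed first coordinates the induction hypothesis compares the fibre
    integrals, which is exactly the hypothesis of the one-dimensional case for these integrals. A
    support condition by coordinates passes to fibres with the same [N], while the height bound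
    grows to [M']. The function [h] is extended-real because its fibre integrals may be infinite. *)
Lemma prekopa_leindler_box n (f g : 'rV[R]_n -> R) (h : 'rV[R]_n -> \bar R)
    (M N : R) :
  measurable_fun setT f -> measurable_fun setT g -> measurable_fun setT h ->
  (forall v, 0 <= f v <= M)%R -> (forall v, 0 <= g v <= M)%R ->
  (forall v, 0 <= h v) ->
  (forall (v : 'rV[R]_n) i, N < `|v ord0 i| -> f v = 0)%R ->
  (forall (v : 'rV[R]_n) i, N < `|v ord0 i| -> g v = 0)%R ->
  (forall v w, (f v `^ t * g w `^ (1 - t))%:E <= h (t *: v + (1 - t) *: w)%R) ->
  ((fine (\int[rV_lebesgue R n]_v (f v)%:E)) `^ t *
   (fine (\int[rV_lebesgue R n]_v (g v)%:E)) `^ (1 - t))%:E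
    <= \int[rV_lebesgue R n]_v h v.
Proof.
elim: n f g h M => [|n IH] f g h M mf mg mh fM gM h0 fN gN fgh.
  rewrite /= !integral_dirac ?diracT ?mul1e//.
  - by have := fgh 0%R 0%R; rewrite [X in h X]thinmx0.
  - exact/measurable_EFinP.
  - exact/measurable_EFinP.
have mfE : measurable_fun setT (EFin \o f) by exact/measurable_EFinP.
have mgE : measurable_fun setT (EFin \o g) by exact/measurable_EFinP.
have fE0 v : 0 <= (EFin \o f) v by rewrite lee_fin; case/andP : (fM v).
have gE0 v : 0 <= (EFin \o g) v by rewrite lee_fin; case/andP : (gM v).
have M0 : (0 <= M)%R by have /andP[] := fM 0%R; exact: le_trans.
pose M' := (M * ((`|N| + 1) *+ 2) ^+ n)%R.
have sect (k : 'rV[R]_n.+1 -> R) : measurable_fun setT k ->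
    (forall v, 0 <= k v <= M)%R -> (forall (v : 'rV[R]_n.+1) i, N < `|v ord0 i| -> k v = 0)%R ->
  [/\ forall x : measurableTypeR R, measurable_fun setT (fun v => k (rV_cons (x, v))),
      forall (x : measurableTypeR R) (v : 'rV[R]_n) i,
        (N < `|v ord0 i| -> k (rV_cons (x, v)) = 0)%R,
      forall x : measurableTypeR R, 0 <= \int[rV_lebesgue R n]_v (k (rV_cons (x, v)))%:E <= M'%:E &
      forall x : measurableTypeR R, (N < `|x : R|)%R ->
       \int[rV_lebesgue R n]_v (k (rV_cons (x, v)))%:E = 0].
  move=> mk kM kN.
  have mkE : measurable_fun setT (EFin \o k) by exact/measurable_EFinP.
  have mkx (x : measurableTypeR R) : measurable_fun setT (fun v => k (rV_cons (x, v))).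
    by apply/measurable_EFinP; exact: (measurable_fun_rV_cons mkE).
  have kxN (x : measurableTypeR R) (v : 'rV[R]_n) i : (N < `|v ord0 i| -> k (rV_cons (x, v)) = 0)%R.
    by have /= := rV_consS i (x, v); rewrite /rV_coord => <-; exact: kN.
  split => //.
  - move=> x; apply/andP; split; last first.
      exact: (le_integral_box (mkx x) (fun v => kM (rV_cons (x, v))) (kxN x)).
    by apply: integral_ge0 => v _; rewrite lee_fin; case/andP : (kM (rV_cons (x, v))).
  - move=> x xN; apply: integral0_eq => v _; rewrite (kN _ ord0)//.
    by have /= := rV_cons0 (x, v); rewrite /rV_coord => ->.
have [mfx fxN fxM f00] := sect f mf fM fN.
have [mgx gxN gxM g00] := sect g mg gM gN.
pose F (x : measurableTypeR R) := fine (\int[rV_lebesgue R n]_v (f (rV_cons (x, v)))%:E).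
pose G (x : measurableTypeR R) := fine (\int[rV_lebesgue R n]_v (g (rV_cons (x, v)))%:E).
have FE x : (F x)%:E = \int[rV_lebesgue R n]_v (f (rV_cons (x, v)))%:E.
  rewrite fineK// ge0_fin_numE; last by case/andP : (fxM x).
  by case/andP : (fxM x) => _ /le_lt_trans; apply; exact: ltry.
have GE x : (G x)%:E = \int[rV_lebesgue R n]_v (g (rV_cons (x, v)))%:E.
  rewrite fineK// ge0_fin_numE; last by case/andP : (gxM x).
  by case/andP : (gxM x) => _ /le_lt_trans; apply; exact: ltry.
rewrite (ge0_integral_rV_cons mfE fE0) (ge0_integral_rV_cons mgE gE0)
  (ge0_integral_rV_cons mh h0)/=.
rewrite -(eq_integral _ _ (fun x _ => FE x)) -(eq_integral _ _ (fun x _ => GE x)).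
apply: (@prekopa_leindler1 _ t N t01 F G _ M').
- apply: measurableT_comp; first exact: fine_measurable.
  exact: (measurable_integral_rV_cons mfE).
- apply: measurableT_comp; first exact: fine_measurable.
  exact: (measurable_integral_rV_cons mgE).
- exact: (measurable_integral_rV_cons mh).
- by move=> x; rewrite -!lee_fin FE.
- by move=> x; rewrite -!lee_fin GE.
- by move=> x; apply: integral_ge0.
- by move=> x xN; rewrite /F f00.
- by move=> x xN; rewrite /G g00.
move=> x y; apply: (IH (fun v => f (rV_cons (x, v))) (fun v => g (rV_cons (y, v))) _ M) => //.
- exact: (measurable_fun_rV_cons mh).
- exact: fxN.
- exact: gxN.
- by move=> v w; rewrite -rV_cons_comb.
Qed.

(** One parameter cuts off both height and support, which gives the increasing approximations to
    which [prekopa_leindler_box] applies. *)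
Definition truncate n (f : 'rV[R]_n -> R) (k : nat) (v : 'rV[R]_n) : R :=
  (\1_(eball k%:R) v * Num.min (f v) k%:R)%R.

Lemma measurable_truncate n (f : 'rV[R]_n -> R) k :
  measurable_fun setT f -> measurable_fun setT (truncate f k).
Proof.
move=> mf; apply: measurable_funM.
  by apply: measurable_indic; exact: measurable_eball.
exact: measurable_minr.
Qed.

Lemma truncate_bounds n (f : 'rV[R]_n -> R) k v : (0 <= f v)%R ->
  (0 <= truncate f k v <= Num.min (f v) k%:R)%R.
Proof.
move=> fv; have m0 : (0 <= Num.min (f v) k%:R)%R by rewrite le_min fv ler0n.
rewrite /truncate indicE; case: (_ \in _); first by rewrite mul1r m0 lexx.
by rewrite mul0r lexx.
Qed.

Lemma le_truncate n (f : 'rV[R]_n -> R) k k' v : (0 <= f v)%R -> (k <= k')%N ->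
  (truncate f k v <= truncate f k' v)%R.
Proof.
move=> fv kk'; have [ev|ev] := ltP (enorm v) k%:R.
  rewrite /truncate !indicE !mem_set//= ?mul1r; last first.
    by apply: lt_le_trans ev _; rewrite ler_nat.
  by rewrite le_min ge_min lexx/= ge_min ler_nat kk' orbT.
rewrite {1}/truncate indicE memNset ?mul0r; last by apply/negP; rewrite -leNgt.
by case/andP : (truncate_bounds k' fv).
Qed.

Lemma lt_integral_truncate n (f : 'rV[R]_n -> R) (c : R) :
  measurable_fun setT f -> (forall v, 0 <= f v)%R ->
  c%:E < \int[rV_lebesgue R n]_v (f v)%:E ->
  exists k, c%:E < \int[rV_lebesgue R n]_v (truncate f k v)%:E.
Proof.
move=> mf f0 cf; apply: contrapT => /forallNP nk.
have mfk k : measurable_fun setT (EFin \o truncate f k).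
  by apply/measurable_EFinP; exact: measurable_truncate.
have fk0 k v : setT v -> 0 <= (EFin \o truncate f k) v.
  by move=> _; rewrite lee_fin; case/andP : (truncate_bounds k (f0 v)).
have ndf v : setT v -> {homo (fun k => (EFin \o truncate f k) v) : k k' / (k <= k')%N >-> k <= k'}.
  by move=> _ k k' kk'; rewrite lee_fin le_truncate.
move: cf; rewrite (_ : \int[_]_v (f v)%:E =
    \int[rV_lebesgue R n]_v limn (fun k => (EFin \o truncate f k) v)); last first.
  (* At a fixed [v] the truncations equal [f v] as soon as [k] exceeds both [f v] and the norm of
     [v]. *)
  apply: eq_integral => v _; apply/esym/lim_near_cst => //.
  near=> k; rewrite /= /truncate indicE mem_set.
    rewrite mul1r min_l//; near: k; exact: nbhs_infty_ger.
  rewrite /eball/= (@lt_le_trans _ _ (enorm v + 1)%R)// ?ltrDl//.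
  by near: k; exact: nbhs_infty_ger.
rewrite (monotone_convergence _ measurableT mfk fk0 ndf) ltNge => /negP; apply.
apply: lime_le.
  apply/cvg_ex; eexists; exact: (cvg_monotone_convergence measurableT mfk fk0 ndf).
by apply: nearW => k; rewrite leNgt; apply/negP; exact: nk.
Unshelve. all: by end_near. Qed.

(** A strict common lower bound [c] survives truncation at a large enough [k], and the geometric
    mean of [c] with itself is [c]. In this form the integrals of [f] and [g] may be infinite. *)
Lemma prekopa_leindler_lt n (f g : 'rV[R]_n -> R) (h : 'rV[R]_n -> \bar R) (c : R) :
  measurable_fun setT f -> measurable_fun setT g -> measurable_fun setT h ->
  (forall v, 0 <= f v)%R -> (forall v, 0 <= g v)%R -> (forall v, 0 <= h v) ->
  (forall v w, (f v `^ t * g w `^ (1 - t))%:E <= h (t *: v + (1 - t) *: w)%R) ->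
  (0 <= c)%R ->
  c%:E < \int[rV_lebesgue R n]_v (f v)%:E ->
  c%:E < \int[rV_lebesgue R n]_v (g v)%:E ->
  c%:E <= \int[rV_lebesgue R n]_v h v.
Proof.
move=> mf mg mh f0 g0 h0 fgh c0.
move=> /(lt_integral_truncate mf f0)[k1 cf] /(lt_integral_truncate mg g0)[k2 cg].
pose k := maxn k1 k2.
have cI (q : 'rV[R]_n -> R) j : measurable_fun setT q -> (forall v, 0 <= q v)%R -> (j <= k)%N ->
    c%:E < \int[rV_lebesgue R n]_v (truncate q j v)%:E ->
    (c <= fine (\int[rV_lebesgue R n]_v (truncate q k v)%:E))%R.
  move=> mq q0 jk cj.
  have b : forall v, (0 <= truncate q k v <= k%:R)%R.
    move=> v; have /andP[-> /le_trans] := truncate_bounds k (q0 v).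
    by apply; rewrite ge_min lexx orbT.
  rewrite -lee_fin fineK.
    apply/ltW/(lt_le_trans cj); apply: ge0_le_integral => //.
    - by move=> v _; rewrite lee_fin; case/andP : (truncate_bounds j (q0 v)).
    - by apply/measurable_EFinP; exact: measurable_truncate.
    - by apply/measurable_EFinP; exact: measurable_truncate.
    - by move=> v _; rewrite lee_fin le_truncate.
  rewrite ge0_fin_numE; last by apply: integral_ge0 => v _; rewrite lee_fin; case/andP : (b v).
  apply: (le_lt_trans (@le_integral_box n _ k%:R k%:R _ b _)); last exact: ltry.
    exact: measurable_truncate.
  move=> v i vi; rewrite /truncate indicE memNset ?mul0r// /eball/=; apply/negP.
  by rewrite -leNgt (le_trans (ltW vi))// le_coord_enorm.
have cfk := cI f k1 mf f0 (leq_maxl _ _) cf.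
have cgk := cI g k2 mg g0 (leq_maxr _ _) cg.
have b (q : 'rV[R]_n -> R) : (forall v, 0 <= q v)%R -> forall v, (0 <= truncate q k v <= k%:R)%R.
  move=> q0 v; have /andP[-> /le_trans] := truncate_bounds k (q0 v).
  by apply; rewrite ge_min lexx orbT.
have s (q : 'rV[R]_n -> R) : forall (v : 'rV[R]_n) i, (k%:R < `|v ord0 i| -> truncate q k v = 0)%R.
  move=> v i vi; rewrite /truncate indicE memNset ?mul0r// /eball/=; apply/negP.
  by rewrite -leNgt (le_trans (ltW vi))// le_coord_enorm.
apply: le_trans (@prekopa_leindler_box n _ _ h _ _ (measurable_truncate k mf)
  (measurable_truncate k mg) mh (b f f0) (b g g0) h0 (s f) (s g) _).
  rewrite lee_fin.
  have t0 : (0 <= t)%R by case/andP : t01 => /ltW.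
  have t1 : (0 <= 1 - t)%R by case/andP : t01 => _ /ltW; rewrite subr_ge0.
  have [->//|cn0] := eqVneq c 0%R; first by rewrite mulr_ge0// powR_ge0.
  rewrite -[leLHS]powRr1// -{1}(subrK t 1%R) addrC powRD; last by rewrite cn0 implybT.
  by rewrite ler_pM ?powR_ge0// ge0_ler_powR// nnegrE// (le_trans c0).
move=> v w; apply: le_trans (fgh v w); rewrite lee_fin.
have t0 : (0 <= t)%R by case/andP : t01 => /ltW.
have t1 : (0 <= 1 - t)%R by case/andP : t01 => _ /ltW; rewrite subr_ge0.
have h1 (q : 'rV[R]_n -> R) u : (forall v, 0 <= q v)%R -> (0 <= truncate q k u <= q u)%R.
  move=> q0; have /andP[-> /le_trans] := truncate_bounds k (q0 u).
  by apply; rewrite ge_min lexx.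
have /andP[? ?] := h1 f v f0. have /andP[? ?] := h1 g w g0.
by rewrite ler_pM ?powR_ge0// ge0_ler_powR// nnegrE.
Qed.

End prekopa_leindler.

(** * Log-concave functions: marginals and boundedness *)

Section log_concave_functions.
Context (R : realType).

(** As [t] and [1 - t] are nonzero, powers of 0 are 0, so the left side vanishes as soon as [f x] or
    [f y] does. *)
Definition log_concave_fun n (f : 'rV[R]_n -> R) : Prop :=
  forall (x y : 'rV[R]_n) (t : R), 0 < t < 1 ->
    f x `^ t * f y `^ (1 - t) <= f (t *: x + (1 - t) *: y).

Lemma log_concave_fun_expeR n (phi : 'rV[R]_n -> \bar R) :
  (forall x, phi x != -oo%E) -> convex_ereal phi ->
  log_concave_fun (fun x => fine (expeR (- phi x))).
Proof.
move=> phiNy cphi x y t t01.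
have /andP[t0 t1] := t01.
have f0 z : 0 <= fine (expeR (- phi z)) by rewrite fine_ge0// expeR_ge0.
have := cphi x y t t01; have := phiNy (t *: x + (1 - t) *: y)%R.
have := phiNy x; have := phiNy y; have := f0 (t *: x + (1 - t) *: y)%R.
case: (phi x) => [a| |]//; last first.
  by move=> fz *; rewrite [fine (expeR (- +oo))]/= (@powR0 _ t) ?gt_eqF// mul0r.
case: (phi y) => [b| |]//; last first.
  by move=> fz *; rewrite [fine (expeR (- +oo))]/= (@powR0 _ (1 - t)) ?gt_eqF ?subr_gt0// mulr0.
case: (phi _) => [c| |]// _ _ _ _.
rewrite -!EFinM -EFinD lee_fin/= => cab.
have pe r u : expR r `^ u = expR (u * r) :> R.
  by rewrite /powR gt_eqF ?expR_gt0// expRK.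
by rewrite !pe -expRD ler_expR; lra.
Qed.

Local Open Scope ereal_scope.

(** Quasi-concave part of Prekopa's theorem on marginals of jointly log-concave kernels. *)
Lemma log_concave_fun_integral n (F : 'rV[R]_n -> 'rV[R]_n -> R)
    (x y : 'rV[R]_n) (t c : R) : (0 < t < 1)%R ->
  (forall x, measurable_fun setT (F x)) -> (forall x v, 0 <= F x v)%R ->
  (forall v w, F x v `^ t * F y w `^ (1 - t) <=
    F (t *: x + (1 - t) *: y) (t *: v + (1 - t) *: w))%R ->
  (0 <= c)%R ->
  c%:E < \int[rV_lebesgue R n]_v (F x v)%:E ->
  c%:E < \int[rV_lebesgue R n]_v (F y v)%:E ->
  c%:E <= \int[rV_lebesgue R n]_v (F (t *: x + (1 - t) *: y)%R v)%:E.
Proof.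
move=> t01 mF F0 lcF c0; apply: (prekopa_leindler_lt t01) => //.
  exact/measurable_EFinP.
by move=> v; rewrite lee_fin.
Qed.

(* If f > c on K then f >= sqrt (f x * c) on the midpoint set (x + K) / 2, whose
   volume does not depend on x. *)
Lemma log_concave_fun_bounded n (f : 'rV[R]_n -> R) :
  measurable_fun setT f -> (forall v, 0 <= f v)%R -> log_concave_fun f ->
  \int[rV_lebesgue R n]_v (f v)%:E = 1 ->
  exists M, forall v, (f v <= M)%R.
Proof.
move=> mf f0 lcf f1.
have mfE : measurable_fun setT (EFin \o f) by exact/measurable_EFinP.
have fE0 v : 0 <= (EFin \o f) v by rewrite lee_fin.
have mK c : measurable [set v | c%:E < (EFin \o f) v].
  by rewrite -[X in measurable X]setTI; exact: emeasurable_fun_o_infty.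
(* If all these sets were null, the layer cake formula would make the integral of [f] zero. *)
have [c c0 cK] : exists2 c, (0 < c)%R & 0 < rV_lebesgue R n [set v | c%:E < (EFin \o f) v].
  apply: contrapT => nc.
  have : \int[rV_lebesgue R n]_v (EFin \o f) v <= 0; last by rewrite f1 lee_fin ler10.
  rewrite (layer_cake _ mfE)// integral0_eq// => u; rewrite /= in_itv/= andbT => u0.
  apply/eqP; rewrite eq_le measure_ge0 andbT leNgt; apply/negP => uK.
  by apply: nc; exists u.
set K := [set v | _] in cK.
(* A real lower bound is enough, and it spares a proof that [K] has finite volume. *)
have [k k0 kK] : exists2 k : R, (0 < k)%R & k%:E <= rV_lebesgue R n K.
  case E : (rV_lebesgue R n K) cK => [r| |]// r0.
    by exists r.
  by exists 1%R; rewrite ?leey.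
pose q : R := ((2^-1 ^+ n) * k)%R.
have q0 : (0 < q)%R by rewrite mulr_gt0// exprn_gt0// invr_gt0.
(* Solves [sqrt (f x * c) * q <= 1] for [f x], where [q] bounds the volume of every midpoint set
   from below. *)
exists (((q^-1) ^+ 2) / c)%R => x.
have [fx0|] := ltP 0%R (f x); last first.
  by move=> /le_trans; apply; rewrite divr_ge0 ?exprn_ge0 ?invr_ge0 ?ltW.
pose S := [set y : 'rV[R]_n | K (2 *: y + (- x))%R].
have mS : measurable S.
  by rewrite -[X in measurable X]setTI; exact: (measurable_rV_affine 2 (- x)%R _ (mK c)).
have qS : q%:E <= rV_lebesgue R n S.
  have -> : rV_lebesgue R n S = (2^-1 ^+ n)%:E * rV_lebesgue R n K.
    by rewrite -(rV_lebesgue_affine (- x)%R)//; exact: mK.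
  by rewrite /q EFinM lee_pmul2l ?lte_fin ?exprn_gt0 ?invr_gt0// ltry.
pose m := Num.sqrt (f x * c).
have fS y : S y -> (m <= f y)%R.
  rewrite /S /K/= lte_fin => /ltW cy.
  have h : (0 < (2^-1 : R) < 1)%R by lra.
  have := lcf x (2 *: y + (- x))%R 2^-1%R h.
  have -> : (2^-1 *: x + (1 - 2^-1) *: (2 *: y - x) = y)%R.
    rewrite (_ : (1 - 2^-1 = 2^-1 :> R)%R); last by lra.
    by rewrite -scalerDr addrC subrK scalerA mulVf ?scale1r// pnatr_eq0.
  rewrite (_ : (1 - 2^-1 = 2^-1 :> R)%R); last by lra.
  rewrite !powR12_sqrt// -sqrtrM//; apply: le_trans.
  by rewrite /m ler_wsqrtr// ler_wpM2l.
have : (m * q)%:E <= 1.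
  rewrite -f1; apply: (@le_trans _ _ (\int[rV_lebesgue R n]_(y in S) (f y)%:E)); last first.
    by apply: ge0_subset_integral => // y _; rewrite lee_fin.
  apply: (@le_trans _ _ (\int[rV_lebesgue R n]_(y in S) (cst m%:E) y)).
    by rewrite integral_cst// EFinM lee_wpmul2l// lee_fin sqrtr_ge0.
  apply: ge0_le_integral => //.
  - by move=> y _; rewrite lee_fin sqrtr_ge0.
  - exact: measurable_funTS.
rewrite lee_fin -ler_pdivlMr// mul1r => mq.
rewrite ler_pdivlMr// -(sqr_sqrtr (mulr_ge0 (f0 x) (ltW c0))) ler_sqr ?nnegrE ?sqrtr_ge0//.
by rewrite invr_ge0 ltW.
Qed.

End log_concave_functions.

(** * Densities of c X + W *)

Section density.
Context (R : realType) (n : nat) (dT : measure_display) (T : measurableType dT).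
Context (P : probability T R).
Local Open Scope ereal_scope.
Notation mu := (rV_lebesgue R n).

Lemma density_integral1 (Y : T -> 'rV[R]_n) f :
  is_density P Y f -> \int[mu]_x (f x)%:E = 1.
Proof.
case=> _ _ /(_ _ measurableT) <-.
by rewrite /pushforward preimage_setT probability_setT.
Qed.

(* The density agrees a.e. with the Radon-Nikodym derivative. *)
Lemma ge0_integral_density (Y : {RV P >-> 'rV[R]_n}) f u : is_density P Y f ->
  measurable_fun setT u -> (forall x, 0 <= u x) ->
  \int[distribution P Y]_x u x = \int[mu]_x (u x * (f x)%:E).
Proof.
move=> dY mu_ u0; have [mf f0 fP] := dY.
have mfE : measurable_fun setT (EFin \o f) by exact/measurable_EFinP.
have dom : distribution P Y `<< mu.
  apply/null_content_dominatesP => A mA muA0.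
  rewrite /distribution fP// null_set_integral//.
  exact: measurable_funTS.
rewrite -(Radon_Nikodym_SigmaFinite.change_of_variables dom)//.
set g := Radon_Nikodym_SigmaFinite.f _ _.
have intg : mu.-integrable setT g := Radon_Nikodym_SigmaFinite.f_integrable dom.
have mg : measurable_fun setT g := measurable_int _ intg.
have gf : ae_eq mu setT g (EFin \o f).
  apply: (integral_ae_eq measurableT intg mfE) => A _ mA.
  by rewrite -(Radon_Nikodym_SigmaFinite.f_integral dom)//; exact: fP.
apply: ge0_ae_eq_integral => //.
- exact: emeasurable_funM.
- exact: emeasurable_funM.
- by move=> x _; rewrite mule_ge0// Radon_Nikodym_SigmaFinite.f_ge0.
- by move=> x _; rewrite mule_ge0// lee_fin.
by apply: filterS gf => x /= h /h ->.
Qed.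

Variables (X W : {RV P >-> 'rV[R]_n}) (fX fW : 'rV[R]_n -> R).
Hypotheses (dX : is_density P X fX) (dW : is_density P W fW).

Let mfX : measurable_fun setT fX. Proof. by case: dX. Qed.
Let mfW : measurable_fun setT fW. Proof. by case: dW. Qed.
Let fX0 v : (0 <= fX v)%R. Proof. by case: dX. Qed.
Let fW0 v : (0 <= fW v)%R. Proof. by case: dW. Qed.

Variable c : R.

(** Integrating over the value of [X], rather than of [c X], avoids the density of [c X] and its
    Jacobian factor. *)
Definition conv_kernel (z x : 'rV[R]_n) : R := (fX x * fW (z - c *: x))%R.

Definition conv (z : 'rV[R]_n) : R := fine (\int[mu]_x (conv_kernel z x)%:E).

Lemma conv_kernel_ge0 z x : (0 <= conv_kernel z x)%R.
Proof. exact: mulr_ge0. Qed.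

Lemma measurable_conv_kernel :
  measurable_fun setT (fun p : 'rV[R]_n * 'rV[R]_n => conv_kernel p.1 p.2).
Proof.
apply: measurable_funM; first exact: measurableT_comp.
apply: measurableT_comp => //.
rewrite (_ : (fun p => _) = (fun p : 'rV[R]_n * 'rV[R]_n => 1 *: p.1 + (- c) *: p.2)%R).
  exact: measurable_rV_comb.
by apply/funext => p; rewrite scale1r scaleNr.
Qed.

Lemma measurable_shift (x : 'rV[R]_n) : measurable_fun setT (fun z : 'rV[R]_n => fW (z - c *: x)%R).
Proof.
apply: measurableT_comp => //.
rewrite (_ : (fun z => _) = (fun z : 'rV[R]_n => 1 *: z + (- (c *: x)))%R).
  exact: measurable_rV_affine.
by apply/funext => p; rewrite scale1r.
Qed.

Lemma integral_conv (A : set 'rV[R]_n) : measurable A ->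
  \int[mu]_(z in A) \int[mu]_x (conv_kernel z x)%:E =
  \int[mu]_x ((fX x)%:E * \int[mu]_(z in A) (fW (z - c *: x)%R)%:E).
Proof.
move=> mA.
pose k (p : 'rV[R]_n * 'rV[R]_n) : \bar R := (conv_kernel p.1 p.2)%:E * (\1_A p.1)%:E.
have mk : measurable_fun setT k.
  apply: emeasurable_funM; first by apply/measurable_EFinP; exact: measurable_conv_kernel.
  apply/measurable_EFinP; apply: (measurableT_comp (f := \1_A : 'rV[R]_n -> R)) => //.
have k0 p : 0 <= k p by rewrite mule_ge0// lee_fin// conv_kernel_ge0.
have patchE' (f : 'rV[R]_n -> \bar R) z : (f \_ A) z = f z * (\1_A z)%:E.
  by rewrite epatch_indic.
rewrite integral_mkcond.
transitivity (\int[mu]_z \int[mu]_x k (z, x)).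
  apply: eq_integral => z _; rewrite patchE' /k/=.
  have mkz : measurable_fun setT (fun x => (conv_kernel z x)%:E).
    apply/measurable_EFinP.
    exact: (measurableT_comp measurable_conv_kernel (pair1_measurable z)).
  by rewrite (ge0_integralZr mu measurableT mkz)// => x _; rewrite lee_fin conv_kernel_ge0.
rewrite (fubini_tonelli k)//; apply: eq_integral => x _.
rewrite [in RHS]integral_mkcond -ge0_integralZl ?lee_fin//; last 2 first.
- apply/(measurable_restrictT _ mA).
  by apply/measurable_EFinP; apply: measurable_funTS; exact: measurable_shift.
- by move=> z _; rewrite patchE'; rewrite mule_ge0// lee_fin.
by apply: eq_integral => z _; rewrite patchE' /k/= /conv_kernel EFinM muleA.
Qed.

Hypothesis indXW : independent P X W.

(** Independence gives the joint law the right values on rectangles, so it is the product of the two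
    laws by uniqueness of the product measure. The value at [A] is then an integral of section
    measures against the law of [X], and a translation brings each section back to [A]. *)
Lemma probability_comb (A : set 'rV[R]_n) : measurable A ->
  pushforward P (fun w => c *: X w + W w)%R A =
  \int[mu]_x ((fX x)%:E * \int[mu]_(z in A) (fW (z - c *: x)%R)%:E).
Proof.
move=> mA.
pose E := [set p : 'rV[R]_n * 'rV[R]_n | A (c *: p.1 + 1 *: p.2)%R].
have mE : measurable E.
  by rewrite -[X in measurable X]setTI; exact: measurable_rV_comb.
have mXW : measurable_fun setT (fun w => (X w, W w)).
  by apply: measurable_fun_pair.
pose joint := measure_function_pushforward__canonical__measure_function_Measure P mXW.
have jointE : (distribution P X \x distribution P W) E = joint E.
  exact: product_measure_unique.
have -> : pushforward P (fun w => c *: X w + W w)%R A = joint E.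
  rewrite /joint/= /pushforward; congr (P _).
  by apply/seteqP; split => w; rewrite /E/= scale1r.
rewrite -jointE /= /product_measure1 (ge0_integral_density dX)//; last first.
  exact: measurable_fun_xsection.
apply: eq_integral => x _; rewrite muleC; congr (_ * _).
rewrite /= (_ : xsection E x = [set w | A (1 *: w + c *: x)%R]); last first.
  by apply/seteqP; split => w; rewrite /xsection/= inE /E/= addrC.
have mA' : measurable [set w : 'rV[R]_n | A (1 *: w + c *: x)%R].
  by rewrite -[X in measurable X]setTI; exact: measurable_rV_affine.
have [_ _ fWP] := dW.
rewrite /distribution fWP// integral_mkcond [RHS]integral_mkcond.
have := @ge0_integral_rV_affine R n 1%R (c *: x)%R
  ((fun z => (fW (z - c *: x)%R)%:E) \_ A) ltr01.
rewrite invr1 expr1n mul1e => <-.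
- apply: eq_integral => w _; rewrite !patchE.
  have -> : (w \in [set w | A (1 *: w + c *: x)%R]) = ((1 *: w + c *: x)%R \in A).
    by apply/idP/idP; rewrite !inE.
  by rewrite scale1r addrK.
- apply/(measurable_restrictT _ mA).
  by apply/measurable_EFinP; apply: measurable_funTS; exact: measurable_shift.
- by move=> z; rewrite patchE; case: ifPn; rewrite ?lee_fin.
Qed.

Variable M : R.
Hypothesis fWM : forall v, (fW v <= M)%R.

(** A bounded [fW] makes the convolution integral finite at every point, not just almost everywhere,
    so [fine] in [conv] is faithful. *)
Lemma conv_integral_le z : \int[mu]_x (conv_kernel z x)%:E <= M%:E.
Proof.
apply: (@le_trans _ _ (\int[mu]_x (M%:E * (fX x)%:E))).
  apply: ge0_le_integral => //.
  - by move=> x _; rewrite lee_fin conv_kernel_ge0.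
  - apply/measurable_EFinP.
    exact: (measurableT_comp measurable_conv_kernel (pair1_measurable z)).
  - by apply: measurable_funeM; exact/measurable_EFinP.
  - by move=> x _; rewrite -EFinM lee_fin /conv_kernel mulrC ler_wpM2r.
rewrite ge0_integralZl//.
- by rewrite (density_integral1 dX) mule1.
- exact/measurable_EFinP.
- by move=> x _; rewrite lee_fin.
- by rewrite lee_fin (le_trans (fW0 0%R)).
Qed.

Lemma convE z : (conv z)%:E = \int[mu]_x (conv_kernel z x)%:E.
Proof.
have I0 : 0 <= \int[mu]_x (conv_kernel z x)%:E.
  by apply: integral_ge0 => x _; rewrite lee_fin conv_kernel_ge0.
by rewrite fineK// ge0_fin_numE// (le_lt_trans (conv_integral_le z))// ltry.
Qed.

Lemma conv_le z : (conv z <= M)%R.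
Proof. by rewrite -lee_fin convE conv_integral_le. Qed.

Lemma conv_ge0 z : (0 <= conv z)%R.
Proof.
rewrite -lee_fin convE.
by apply: integral_ge0 => x _; rewrite lee_fin conv_kernel_ge0.
Qed.

Lemma measurable_conv : measurable_fun setT conv.
Proof.
apply/measurable_EFinP; rewrite (funext convE : EFin \o conv = _).
apply: (measurable_fun_fubini_tonelli_F (m2 := mu)
  (fun p : 'rV[R]_n * 'rV[R]_n => (conv_kernel p.1 p.2)%:E)).
- by apply/measurable_EFinP; exact: measurable_conv_kernel.
- by move=> p; rewrite lee_fin conv_kernel_ge0.
Qed.

Lemma is_density_conv : is_density P (fun w => c *: X w + W w)%R conv.
Proof.
split; [exact: measurable_conv|exact: conv_ge0|move=> A mA].
rewrite probability_comb// -integral_conv//.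
by apply: eq_integral => z _; rewrite convE.
Qed.

(** The kernel is jointly log-concave in [z] and [x], being a product of log-concave functions of
    linear forms. The bound on marginals has a non-strict conclusion, so it is applied at a level
    [s'] strictly above [s]. *)
Lemma conv_convex_superlevel s : log_concave_fun fX -> log_concave_fun fW ->
  (0 <= s)%R -> forall x y t, (0 < t < 1)%R -> (s < conv x)%R -> (s < conv y)%R ->
  (s < conv (t *: x + (1 - t) *: y))%R.
Proof.
move=> lcX lcW s0 x y t t01 sx sy.
pose s' := ((s + Num.min (conv x) (conv y)) / 2)%R.
have smin : (s < Num.min (conv x) (conv y))%R by rewrite lt_min sx.
have ss' : (s < s')%R by rewrite /s'; lra.
have s'm : (s' < Num.min (conv x) (conv y))%R by rewrite /s'; lra.
have /andP[s'x s'y] : (s' < conv x)%R && (s' < conv y)%R by rewrite -lt_min.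
apply: (lt_le_trans ss'); rewrite -lee_fin convE.
apply: (@log_concave_fun_integral _ _ conv_kernel x y t s') => //.
- by move=> z; exact: (measurableT_comp measurable_conv_kernel (pair1_measurable z)).
- exact: conv_kernel_ge0.
- move=> v w; rewrite /conv_kernel !powRM// mulrACA.
  apply: ler_pM; rewrite ?mulr_ge0 ?powR_ge0//; first exact: lcX.
  have := lcW (x - c *: v)%R (y - c *: w)%R t t01.
  congr (_ <= fW _)%R.
  rewrite !scalerBr !scalerA !scalerDr !scalerA !(mulrC c) opprD.
  by rewrite addrACA.
- by rewrite (le_trans s0)// ltW.
- by rewrite -convE lte_fin.
- by rewrite -convE lte_fin.
Qed.

End density.

(** * Hinge integrals *)

Section hinge.
Context (R : realType) (n : nat) (dT : measure_display) (T : measurableType dT).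
Context (P : probability T R).
Local Open Scope ereal_scope.
Notation mu := (rV_lebesgue R n).

Definition hinge (s : R) (f : 'rV[R]_n -> R) (x : 'rV[R]_n) : R := Num.max (f x - s)%R 0%R.

Lemma hinge_ge0 s f x : (0 <= hinge s f x)%R.
Proof. by rewrite /hinge le_max lexx orbT. Qed.

Lemma measurable_hinge s (f : 'rV[R]_n -> R) :
  measurable_fun setT f -> measurable_fun setT (hinge s f).
Proof. by move=> mf; apply: measurable_maxr => //; exact: measurable_funB. Qed.

Lemma measurable_superlevel s (f : 'rV[R]_n -> R) :
  measurable_fun setT f -> measurable [set x | (s < f x)%R].
Proof.
move=> mf; rewrite -[X in measurable X]setTI.
have : measurable_fun setT (fun v : 'rV[R]_n => (s < f v)%R).
  by apply: measurable_fun_ltr.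
by move=> /(_ measurableT [set true]); exact.
Qed.

Section density.
Variables (Y : T -> 'rV[R]_n) (f : 'rV[R]_n -> R).
Hypothesis dY : is_density P Y f.
Variable s : R.
Hypothesis s0 : (0 <= s)%R.

Let mf : measurable_fun setT f. Proof. by case: dY. Qed.
Let f0 x : (0 <= f x)%R. Proof. by case: dY. Qed.
Let mh : measurable_fun setT (fun x => (hinge s f x)%:E).
Proof. by apply/measurable_EFinP; exact: measurable_hinge. Qed.

Lemma pushforward_le_hinge (A : set 'rV[R]_n) : measurable A ->
  pushforward P Y A <= \int[mu]_x (hinge s f x)%:E + s%:E * mu A.
Proof.
move=> mA; have [_ _ ->//] := dY.
apply: (@le_trans _ _ (\int[mu]_(x in A) ((hinge s f x)%:E + s%:E))).
  apply: ge0_le_integral => //.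
  - by move=> x _; rewrite lee_fin.
  - by apply: measurable_funTS; exact/measurable_EFinP.
  - by apply: emeasurable_funD => //; apply: measurable_funTS.
  - by move=> x _; rewrite -EFinD lee_fin /hinge -lerBlDr le_max lexx.
rewrite ge0_integralD//; last 2 first.
- by move=> x _; rewrite lee_fin hinge_ge0.
- exact: measurable_funTS.
apply: leeD; last by rewrite integral_cst.
by apply: ge0_subset_integral => // x _; rewrite lee_fin hinge_ge0.
Qed.

(** Equality case of [pushforward_le_hinge]: the hinge function is [f - s] on this set and zero
    outside it. *)
Lemma pushforward_superlevel :
  pushforward P Y [set x | (s < f x)%R] =
  \int[mu]_x (hinge s f x)%:E + s%:E * mu [set x | (s < f x)%R].
Proof.
have mK := measurable_superlevel s mf.
have [_ _ ->//] := dY.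
rewrite (_ : \int[mu]_x (hinge s f x)%:E =
    \int[mu]_(x in [set x | (s < f x)%R]) (hinge s f x)%:E); last first.
  rewrite [RHS]integral_mkcond; apply: eq_integral => x _.
  rewrite patchE; case: ifPn => //; rewrite notin_setE/= => /negP; rewrite -leNgt => fs.
  by rewrite /hinge max_r// subr_le0.
rewrite -integral_cst//= -ge0_integralD//; last 2 first.
- by move=> x _; rewrite lee_fin hinge_ge0.
- exact: measurable_funTS.
apply: eq_integral => x; rewrite inE/= => sf.
by rewrite -EFinD /hinge max_l ?subrK// subr_ge0 ltW.
Qed.

(** Finiteness is claimed for the product: at [s = 0] the set may have infinite volume, but 0 times
    [+oo] is 0. It allows this term to be cancelled when two hinge integrals are compared. *)
Lemma superlevel_fin : s%:E * mu [set x | (s < f x)%R] \is a fin_num.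
Proof.
rewrite ge0_fin_numE; last by rewrite mule_ge0.
apply: (@le_lt_trans _ _ (pushforward P Y [set x | (s < f x)%R])).
  by rewrite pushforward_superlevel leeDr// integral_ge0// => x _; rewrite lee_fin hinge_ge0.
have [_ _ ->//] := dY; last exact: measurable_superlevel.
apply: (@le_lt_trans _ _ 1); last exact: ltry.
rewrite -(density_integral1 dY); apply: ge0_subset_integral => //.
- exact: measurable_superlevel.
- exact/measurable_EFinP.
- by move=> x _; rewrite lee_fin.
Qed.

End density.

(* The hinge integral is the supremum of P (Y in A) - s |A| over measurable A,
   so it depends only on the law of Y. *)
Lemma hinge_density_le (Y Z : T -> 'rV[R]_n) (f g : 'rV[R]_n -> R) (s : R) :
  is_density P Y f -> is_density P Z g -> (0 <= s)%R ->
  (forall e : R, (0 < e)%R -> exists2 A, measurable A &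
    s%:E * mu A = s%:E * mu [set x | (s < f x)%R] /\
    pushforward P Y [set x | (s < f x)%R] <= pushforward P Z A + e%:E) ->
  \int[mu]_x (hinge s f x)%:E <= \int[mu]_x (hinge s g x)%:E.
Proof.
move=> dY dZ s0 h; apply/lee_addgt0Pr => e e0.
have [A mA [muA PA]] := h e e0.
have fin := superlevel_fin dY s0.
rewrite -(leeD2rE _ _ fin) -(pushforward_superlevel dY s0).
apply: (le_trans PA); rewrite addeAC leeD2r//.
by rewrite -muA; exact: pushforward_le_hinge.
Qed.

(** Each superlevel set of one version serves as its own competitor for the other version. This
    transfers the comparison from convolution densities to arbitrary ones. *)
Lemma hinge_density_unique (Y : T -> 'rV[R]_n) (f g : 'rV[R]_n -> R) (s : R) :
  is_density P Y f -> is_density P Y g -> (0 <= s)%R ->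
  \int[mu]_x (hinge s f x)%:E = \int[mu]_x (hinge s g x)%:E.
Proof.
move=> dY dY' s0.
have le (f' g' : 'rV[R]_n -> R) : is_density P Y f' -> is_density P Y g' ->
    \int[mu]_x (hinge s f' x)%:E <= \int[mu]_x (hinge s g' x)%:E.
  move=> d d'; apply: (hinge_density_le d d' s0) => e e0.
  exists [set x | (s < f' x)%R]; first by case: d => mf' _ _; exact: measurable_superlevel.
  by split => //; rewrite leeDl// lee_fin ltW.
by apply/eqP; rewrite eq_le !le.
Qed.

Variables (X W : {RV P >-> 'rV[R]_n}) (fX fW : 'rV[R]_n -> R).
Hypotheses (dX : is_density P X fX) (dW : is_density P W fW).
Hypothesis lcW : log_concave_fun fW.
Hypothesis indXW : independent P X W.

Let mfX : measurable_fun setT fX. Proof. by case: dX. Qed.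
Let mfW : measurable_fun setT fW. Proof. by case: dW. Qed.
Let fX0 v : (0 <= fX v)%R. Proof. by case: dX. Qed.
Let fW0 v : (0 <= fW v)%R. Proof. by case: dW. Qed.

(* u x = P (x + W in K) is quasi-concave; contracting X towards a near-maximizer
   x0 of u can only increase u, up to e. *)
Lemma contraction_probability (l : R) (K : set 'rV[R]_n) (e : R) :
  (0 < l < 1)%R -> (0 < e)%R -> measurable K ->
  (forall x y t, (0 < t < 1)%R -> K x -> K y -> K (t *: x + (1 - t) *: y)%R) ->
  exists a : 'rV[R]_n,
    pushforward P (fun w => 1 *: X w + W w)%R K <=
    pushforward P (fun w => l *: X w + W w)%R [set z | K (1 *: z + a)%R] + e%:E.
Proof.
move=> l01 e0 mK cK.
pose F (x z : 'rV[R]_n) : R := (\1_K z * fW (1 *: z + (- x)))%R.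
have mF x : measurable_fun setT (F x).
  apply: measurable_funM; first exact: measurable_indic.
  by apply: measurableT_comp => //; exact: measurable_rV_affine.
have F0 x z : (0 <= F x z)%R by rewrite mulr_ge0.
pose u x := \int[mu]_z (F x z)%:E.
have u0 x : 0 <= u x by apply: integral_ge0 => z _; rewrite lee_fin.
have u1 x : u x <= 1.
  rewrite -(density_integral1 dW).
  have := @ge0_integral_rV_affine R n 1%R (- x)%R (fun z => (fW z)%:E) ltr01.
  rewrite invr1 expr1n mul1e => <-//; last exact/measurable_EFinP.
  apply: ge0_le_integral => //.
  - by move=> z _; rewrite lee_fin.
  - exact/measurable_EFinP.
  - apply/measurable_EFinP.
    by apply: measurableT_comp => //; exact: measurable_rV_affine.
  - move=> z _; rewrite lee_fin /F indicE; case: (_ \in _); first by rewrite mul1r.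
    by rewrite mul0r.
have ufin x : u x \is a fin_num by rewrite ge0_fin_numE// (le_lt_trans (u1 x))// ltry.
have uquasi x y c : (0 <= c)%R -> c%:E < u x -> c%:E < u y ->
    c%:E <= u (l *: x + (1 - l) *: y)%R.
  move=> c0; apply: log_concave_fun_integral => // v w.
  have /andP[l0 l1] := l01.
  rewrite /F !powRM ?indicE ?ler0n// mulrACA.
  have [Kv|Kv] := pselect (K v); last first.
    by rewrite (memNset Kv) powR0 ?gt_eqF// !mul0r mulr_ge0 ?ler0n.
  have [Kw|Kw] := pselect (K w); last first.
    by rewrite (memNset Kw) (@powR0 _ (1 - l)%R) ?gt_eqF ?subr_gt0// mulr0 !mul0r mulr_ge0 ?ler0n.
  rewrite !mem_set//; last exact: cK.
  rewrite /= !mulr1n !powR1 !mul1r; have := lcW (1 *: v - x)%R (1 *: w - y)%R l01.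
  congr (_ <= fW _)%R; rewrite !scale1r !scalerBr opprD.
  by rewrite addrACA.
pose S := sup (range (fun x => fine (u x))).
have hasS : has_sup (range (fun x => fine (u x))).
  split; first by exists (fine (u 0%R)), 0%R.
  by exists 1%R => _ [x _ <-]; rewrite -lee_fin fineK.
have [_ [x0 _ <-] Sx0] := sup_adherent e0 hasS.
have uS x : (fine (u x) <= S)%R by apply: (ub_le_sup hasS.2); exists x.
(* The level [u x - e] lies strictly below [u x], and below [u x0] because [u x <= S < u x0 + e];
   quasi-concavity applies to it. It can be negative only if [u x < e], where the bound is
   trivial. *)
have ue x : u x <= u (l *: x + (1 - l) *: x0)%R + e%:E.
  have [ce|ce] := ltP (fine (u x)) e.
    apply: (@le_trans _ _ e%:E); last by rewrite leeDr.
    by rewrite -(fineK (ufin x)) lee_fin ltW.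
  rewrite -leeBlDr// -[in leLHS](fineK (ufin x)) -EFinB; apply: uquasi.
  - by rewrite subr_ge0.
  - by rewrite -[ltRHS](fineK (ufin x)) lte_fin ltrBlDr ltrDl.
  - rewrite -[ltRHS](fineK (ufin x0)) lte_fin; apply: le_lt_trans Sx0.
    by rewrite lerB.
exists ((1 - l) *: x0)%R.
set a := ((1 - l) *: x0)%R.
pose K' := [set z | K (1 *: z + a)%R].
have mK' : measurable K'.
  by rewrite -[X in measurable X]setTI; exact: measurable_rV_affine.
rewrite (probability_comb dX dW 1 indXW mK) (probability_comb dX dW l indXW mK').
have uE x : \int[mu]_(z in K) (fW (z - 1 *: x)%R)%:E = u x.
  rewrite integral_mkcond; apply: eq_integral => z _.
  rewrite patchE /F indicE; case: ifPn => _; last by rewrite mul0r.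
  by rewrite mul1r !scale1r.
(* Asking [l x + W] to lie in the translate of [K] by [-a] is asking [l x + a + W] to lie in [K]. *)
have u'E x : \int[mu]_(z in K') (fW (z - l *: x)%R)%:E = u (l *: x + a)%R.
  have := @ge0_integral_rV_affine R n 1%R a (fun z => (F (l *: x + a)%R z)%:E) ltr01.
  rewrite invr1 expr1n mul1e -/(u _) => <-//; last 2 first.
  - exact/measurable_EFinP.
  - by move=> z; rewrite lee_fin.
  rewrite integral_mkcond; apply: eq_integral => z _.
  rewrite patchE /F indicE.
  have -> : (z \in K') = ((1 *: z + a)%R \in K) by apply/idP/idP; rewrite !inE.
  case: ifPn => _; last by rewrite mul0r.
  rewrite mul1r; congr (fW _)%:E.
  by rewrite !scale1r opprD addrACA subrr addr0 // [RHS]addrAC addrK.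
have mu' : measurable_fun setT u.
  apply: (measurable_fun_fubini_tonelli_F (m2 := mu)
    (fun p : 'rV[R]_n * 'rV[R]_n => (F p.1 p.2)%:E)) => [|p]; last by rewrite lee_fin.
  apply/measurable_EFinP; apply: measurable_funM.
    exact: (measurableT_comp (f := \1_K : 'rV[R]_n -> R)).
  apply: measurableT_comp => //.
  rewrite (_ : (fun x : _ * _ => _) = (fun p : 'rV[R]_n * 'rV[R]_n => (-1) *: p.1 + 1 *: p.2)%R).
    exact: measurable_rV_comb.
  by apply/funext => p; rewrite scaleN1r addrC.
have mua : measurable_fun setT (fun x : 'rV[R]_n => u (l *: x + a)%R).
  by apply: measurableT_comp => //; exact: measurable_rV_affine.
have mfXE : measurable_fun setT (EFin \o fX) by exact/measurable_EFinP.
under eq_integral do rewrite uE.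
under [X in _ <= X + _]eq_integral do rewrite u'E.
(* The error is spread over the law of [X], so that the two sides compare pointwise by [ue]. *)
have -> : e%:E = \int[mu]_x ((fX x)%:E * e%:E).
  rewrite ge0_integralZr//; first by rewrite (density_integral1 dX) mul1e.
  - by move=> x _; rewrite lee_fin.
  - by rewrite lee_fin ltW.
rewrite -ge0_integralD//.
- apply: ge0_le_integral => //.
  - by move=> x _; rewrite mule_ge0// lee_fin.
  - exact: emeasurable_funM.
  - by apply: emeasurable_funD; exact: emeasurable_funM.
  - move=> x _; rewrite -muleDr//; last by rewrite ge0_adde_def// inE// lee_fin ltW.
    by rewrite lee_wpmul2l ?lee_fin.
- by move=> x _; rewrite mule_ge0// lee_fin.
- exact: emeasurable_funM.
- by move=> x _; rewrite mule_ge0// lee_fin// ltW.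
- exact: emeasurable_funM.
Qed.

End hinge.

(** * Rearrangements *)

Section ball_volume.
Context (R : realType) (n : nat).
Hypothesis n0 : (0 < n)%N.
Local Open Scope ereal_scope.
Notation mu := (rV_lebesgue R n).

Let k : R := fine (mu (eball 1)).

Let kE : k%:E = mu (eball 1).
Proof.
by rewrite fineK// ge0_fin_numE; [exact: rV_lebesgue_eball1_lty|exact: measure_ge0].
Qed.

Let k0 : (0 < k)%R.
Proof. by rewrite -lte_fin kE; exact: rV_lebesgue_eball1_gt0. Qed.

Let enorm_ge0 (x : 'rV[R]_n) : (0 <= enorm x)%R. Proof. exact: sqrtr_ge0. Qed.

(** Volume of the centered ball with [x] on its boundary. Comparing it with volumes of superlevel
    sets replaces all reasoning about radii of rearranged sets. *)
Definition ball_vol (x : 'rV[R]_n) : R := (k * enorm x ^+ n)%R.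

Lemma ball_vol_ge0 x : (0 <= ball_vol x)%R.
Proof. by rewrite mulr_ge0 ?(ltW k0) ?exprn_ge0. Qed.

Lemma measurable_ball_vol : measurable_fun setT ball_vol.
Proof. by apply: measurable_funM => //; apply: measurable_funX; exact: measurable_enorm. Qed.

Lemma rV_lebesgue_eball_vol (r : R) : (0 < r)%R -> mu (eball r) = (k * r ^+ n)%:E.
Proof. by move=> r0; rewrite rV_lebesgue_eball// -kE -EFinM mulrC. Qed.

Lemma eball_ball_vol (r : R) : (0 < r)%R ->
  eball r = [set x | (ball_vol x < k * r ^+ n)%R].
Proof.
move=> r0; apply/seteqP; split => x; rewrite /eball/= /ball_vol ltr_pM2l//;
  by rewrite ltr_pXn2r// nnegrE ?enorm_ge0// ltW.
Qed.

Lemma radius_of_volume (v : R) : (0 < v)%R ->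
  exists2 r : R, (0 < r)%R & (k * r ^+ n = v)%R.
Proof.
move=> v0; have vk : (0 < v / k)%R by rewrite divr_gt0.
exists ((v / k) `^ n%:R^-1)%R; first by rewrite powR_gt0.
rewrite -powR_mulrn ?powR_ge0// -powRrM mulVf ?pnatr_eq0 -?lt0n//.
by rewrite powRr1 ?(ltW vk)// mulrC divfK// gt_eqF.
Qed.

Lemma rV_lebesgue_ball_vol (v : R) : (0 <= v)%R ->
  mu [set x | (ball_vol x < v)%R] = v%:E.
Proof.
rewrite le_eqVlt => /predU1P[<-|/radius_of_volume[r r0 <-]].
  rewrite (_ : [set x | _] = set0) ?measure0//.
  by apply/seteqP; split => x //=; rewrite ltNge ball_vol_ge0.
by rewrite -eball_ball_vol// rV_lebesgue_eball_vol.
Qed.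

(** Null sets are included: then only radii [r <= 0] have the right volume, and both sides are
    empty. *)
Lemma set_rearrangementE (A : set 'rV[R]_n) : mu A < +oo ->
  set_rearrangement A = [set x | (ball_vol x)%:E < mu A].
Proof.
move=> Aoo; have A0 : 0 <= mu A by exact: measure_ge0.
have : mu A \is a fin_num by rewrite ge0_fin_numE.
move=> /fineK AE; have {A0} : (0 <= fine (mu A))%R by rewrite fine_ge0.
rewrite -AE; set v := fine (mu A); move=> v0.
apply/seteqP; split => x.
  move=> [r/= rA xr]; rewrite lte_fin.
  have r0 : (0 < r)%R by exact: le_lt_trans (enorm_ge0 x) xr.
  move: xr; rewrite -/(eball r x) eball_ball_vol//= => /lt_le_trans; apply.
  by rewrite -lee_fin -rV_lebesgue_eball_vol// rA -AE.
rewrite /= lte_fin => xv.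
have [r r0 rv] := radius_of_volume (le_lt_trans (ball_vol_ge0 x) xv).
exists r; first by rewrite /= rV_lebesgue_eball_vol// rv -AE.
by rewrite eball_ball_vol//= rv.
Qed.

End ball_volume.

Section rearrangement.
Context (R : realType) (n : nat).
Hypothesis n0 : (0 < n)%N.
Local Open Scope ereal_scope.
Notation mu := (rV_lebesgue R n).
Variable f : 'rV[R]_n -> R.
Hypothesis mf : measurable_fun setT f.
Hypothesis f0 : forall x, (0 <= f x)%R.
Hypothesis f1 : \int[mu]_x (f x)%:E = 1.

Lemma markov_superlevel (t : R) : (0 < t)%R -> t%:E * mu [set x | (t < f x)%R] <= 1.
Proof.
move=> t0; have mK := measurable_superlevel t mf.
rewrite -f1 -integral_cst//=.
apply: (@le_trans _ _ (\int[mu]_(x in [set x | (t < f x)%R]) (f x)%:E)).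
  apply: ge0_le_integral => //.
  - by move=> x _; rewrite lee_fin ltW.
  - by apply: measurable_funTS; exact/measurable_EFinP.
  - by move=> x /= /ltW.
apply: ge0_subset_integral => //; first exact/measurable_EFinP.
by move=> x _; rewrite lee_fin.
Qed.

Lemma superlevel_lty (t : R) : (0 < t)%R -> mu [set x | (t < f x)%R] < +oo.
Proof.
move=> t0; apply: (@le_lt_trans _ _ (t^-1%:E)); last exact: ltry.
by have := markov_superlevel t0; rewrite muleC -lee_pdivlMr// mul1e.
Qed.

Lemma superlevel_nonincreasing (s t : R) : (s <= t)%R ->
  mu [set x | (t < f x)%R] <= mu [set x | (s < f x)%R].
Proof.
move=> st; apply: le_measure; rewrite ?inE; try exact: measurable_superlevel.
by move=> x /=; exact: le_lt_trans.
Qed.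

(** Continuity of the measure along the increasing sets where [f > t + 1/(k+1)]. Without it a
    supremum of levels could fail to have the prescribed strict superlevel sets. *)
Lemma superlevel_right_continuous (t : R) (v : \bar R) :
  v < mu [set x | (t < f x)%R] ->
  exists2 s, (t < s)%R & v < mu [set x | (s < f x)%R].
Proof.
move=> vt; apply: contrapT => ns.
pose E (k : nat) := [set x | (t + k.+1%:R^-1 < f x)%R].
have mE k : measurable (E k) by exact: measurable_superlevel.
have EU : [set x | (t < f x)%R] = \bigcup_k E k.
  apply/seteqP; split => [x /= tx|x [k _]]; last first.
    by rewrite /E/=; apply: le_lt_trans; rewrite lerDl.
  have d0 : (0 < f x - t)%R by rewrite subr_gt0.
  have := near_infty_natSinv_lt (PosNum d0) => -[k _ /(_ k (leqnn _))]/= kd.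
  by exists k => //; rewrite /E/= addrC -ltrBrDr.
have ndE : {homo E : i j / (i <= j)%N >-> (i <= j)%O}.
  move=> i j ij; apply/subsetPset => x; rewrite /E/=; apply: le_lt_trans.
  by rewrite lerD2l lef_pV2 ?posrE// ler_nat.
have mU : measurable (\bigcup_k E k) by exact: bigcup_measurable.
have cvgE := nondecreasing_cvg_mu (mu := mu) mE mU ndE.
move: vt; rewrite EU -(cvg_lim _ cvgE)// ltNge => /negP; apply.
apply: lime_le; first by apply/cvg_ex; eexists; exact: cvgE.
apply: nearW => k /=; rewrite leNgt; apply/negP => vE; apply: ns.
by exists (t + k.+1%:R^-1)%R => //; rewrite ltrDl.
Qed.

Notation fs := (rearrangement f).

(** [get] is meaningful only once some function qualifies. The witness at [x] is the supremum of the
    levels [t > 0] whose superlevel set has volume above [ball_vol x]; adjoining 0 gives the value 0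
    when there is no such level. *)
Lemma is_rearrangement_rearrangement : is_rearrangement f fs.
Proof.
apply: (getPex (P := is_rearrangement f)).
pose E (x : 'rV[R]_n) := [set t%:E | t in [set t : R | (0 < t)%R /\
  (ball_vol x)%:E < mu [set y | (t < f y)%R]]].
exists (fun x => ereal_sup ([set 0] `|` E x)); split.
  by move=> x; apply: ereal_sup_ubound; left.
move=> t t0; rewrite (set_rearrangementE n0) ?superlevel_lty//.
apply/seteqP; split => x /=.
  move=> /ereal_sup_gt[_ [->|[t' [t'0 xt'] <-]]].
    by rewrite lte_fin ltNge (ltW t0).
  rewrite lte_fin => /ltW tt'; apply: (lt_le_trans xt').
  exact: superlevel_nonincreasing.
move=> /superlevel_right_continuous[s ts xs].
apply: (@lt_le_trans _ _ s%:E); first by rewrite lte_fin.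
apply: ereal_sup_ubound; right; exists s => //; split => //.
exact: lt_trans ts.
Qed.

Lemma rearrangement_ge0 x : 0 <= fs x.
Proof. by have [] := is_rearrangement_rearrangement. Qed.

Lemma lt_rearrangement (t : R) x : (0 < t)%R ->
  (t%:E < fs x) = ((ball_vol x)%:E < mu [set y | (t < f y)%R]).
Proof.
move=> t0; have [_ /(_ t t0)] := is_rearrangement_rearrangement.
rewrite (set_rearrangementE n0) ?superlevel_lty// => /seteqP[h1 h2].
by apply/idP/idP; [exact: h1|exact: h2].
Qed.

Lemma superlevel_rearrangement (t : R) : (0 < t)%R ->
  [set x | t%:E < fs x] =
  [set x | (ball_vol x < fine (mu [set y | (t < f y)%R]))%R].
Proof.
move=> t0; have := superlevel_lty t0.
rewrite -ge0_fin_numE// => /fineK E.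
by apply/seteqP; split => x /=; rewrite lt_rearrangement// -[in X in _ < X]E lte_fin.
Qed.

Lemma equimeasurable_rearrangement (t : R) : (0 < t)%R ->
  mu [set x | t%:E < fs x] = mu [set x | (t < f x)%R].
Proof.
move=> t0; rewrite superlevel_rearrangement// rV_lebesgue_ball_vol ?fine_ge0//.
by rewrite fineK// ge0_fin_numE// superlevel_lty.
Qed.

Lemma measurable_rearrangement : measurable_fun setT fs.
Proof.
apply: (measurability _ (ErealGenOInfty.measurableE R)) => //.
move=> _ [_ [r ->] <-]; rewrite setTI.
have mpos (t : R) : (0 < t)%R -> measurable [set x | t%:E < fs x].
  move=> t0; rewrite superlevel_rearrangement// -[X in measurable X]setTI.
  have : measurable_fun setT (fun x : 'rV[R]_n => (ball_vol x < fine (mu [set y | (t < f y)%R]))%R).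
    by apply: measurable_fun_ltr => //; exact: measurable_ball_vol.
  by move=> /(_ measurableT [set true]); exact.
rewrite (_ : _ @^-1` _ = [set x | r%:E < fs x]); last first.
  by apply/seteqP; split => x /=; rewrite in_itv/= andbT.
have [r0|] := ltP 0%R r; first exact: mpos.
rewrite le_eqVlt => /predU1P[->|r0]; last first.
  rewrite (_ : [set x | _] = setT)//; apply/seteqP; split => x //= _.
  by apply: lt_le_trans (rearrangement_ge0 x); rewrite lte_fin.
(* The defining property speaks of positive levels, so level 0 is reached as a union over levels
   1/(k+1). *)
rewrite (_ : [set x | _] = \bigcup_(k : nat) [set x | k.+1%:R^-1%:E < fs x]).
  by apply: bigcup_measurable => k _; apply: mpos.
apply/seteqP; split => [x /= x0|x [k _]/=]; last first.
  by apply: lt_trans; rewrite lte_fin.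
have [d d0 dx] : exists2 d : R, (0 < d)%R & d%:E < fs x.
  case: (fs x) x0 => [y| |]// y0; last by exists 1%R; rewrite ?ltry.
  by move: y0; rewrite lte_fin => y0; exists (y / 2)%R; rewrite ?lte_fin; lra.
have := near_infty_natSinv_lt (PosNum d0) => -[k _ /(_ k (leqnn _))]/= kd.
by exists k => //=; apply: lt_trans dx; rewrite lte_fin.
Qed.

(** Counterpart of [hinge] for rearrangements, which may be infinite at the origin. *)
Definition ehinge (s : R) (F : 'rV[R]_n -> \bar R) x := maxe (F x - s%:E) 0.

Lemma measurable_ehinge s (F : 'rV[R]_n -> \bar R) :
  measurable_fun setT F -> measurable_fun setT (ehinge s F).
Proof. by move=> mF; apply: measurable_maxe => //; exact: emeasurable_funB. Qed.

(** By the layer cake formula both sides integrate volumes of superlevel sets at the levels [s + u]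
    with [u > 0], and at positive levels [f] and its rearrangement are equimeasurable. *)
Lemma hinge_rearrangement (s : R) : (0 <= s)%R ->
  \int[mu]_x ehinge s fs x = \int[mu]_x (hinge s f x)%:E.
Proof.
move=> s0; have mh := measurable_ehinge s measurable_rearrangement.
have mh' : measurable_fun setT (EFin \o hinge s f).
  by apply/measurable_EFinP; exact: measurable_hinge.
have h0 x : 0 <= ehinge s fs x by rewrite le_max lexx orbT.
have h0' x : 0 <= (EFin \o hinge s f) x by rewrite lee_fin hinge_ge0.
rewrite (layer_cake mu mh h0) (layer_cake mu mh' h0').
apply: eq_integral => u; rewrite inE/= in_itv/= andbT => u0.
have su : (0 < s + u)%R by rewrite ltr_wpDl.
transitivity (mu [set x | (s + u)%:E < fs x]).
  have un0 : (u%:E < 0 :> \bar R) = false by rewrite lte_fin ltNge (ltW u0).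
  by congr (mu _); apply/seteqP; split => x /=;
    rewrite /ehinge lt_max lteBrDl// -EFinD un0 orbF.
rewrite equimeasurable_rearrangement//; congr (mu _).
by apply/seteqP; split => x /=; rewrite lte_fin /hinge lt_max
  [(u < 0)%R]ltNge (ltW u0) orbF ltrBrDl.
Qed.

End rearrangement.

(** * From hinge integrals to majorization *)

Section majorization.
Local Open Scope ereal_scope.

Lemma majorized_hinge (R : realType) (n : nat) (f g : 'rV[R]_n -> R) : (0 < n)%N ->
  measurable_fun setT f -> (forall x, (0 <= f x)%R) ->
  measurable_fun setT g -> (forall x, (0 <= g x)%R) ->
  \int[rV_lebesgue R n]_x (f x)%:E = 1 ->
  \int[rV_lebesgue R n]_x (g x)%:E = 1 ->
  (forall s : R, (0 <= s)%R -> \int[rV_lebesgue R n]_x (hinge s f x)%:E <=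
    \int[rV_lebesgue R n]_x (hinge s g x)%:E) ->
  majorized f g.
Proof.
move=> n0 mf f0 mg g0 f1 g1 fg r r0.
set mu := rV_lebesgue R n.
pose F := rearrangement f. pose G := rearrangement g.
have mF : measurable_fun setT F by exact: measurable_rearrangement.
have mG : measurable_fun setT G by exact: measurable_rearrangement.
have F0 x : 0 <= F x by exact: rearrangement_ge0.
have G0 x : 0 <= G x by exact: rearrangement_ge0.
have mB := @measurable_eball R n r.
pose v := fine (mu (eball r)).
have vE : mu (eball r) = v%:E by rewrite /v rV_lebesgue_eball_vol.
have v0 : (0 < v)%R.
  rewrite -lte_fin -vE rV_lebesgue_eball// mule_gt0 ?lte_fin ?exprn_gt0//.
  exact: rV_lebesgue_eball1_gt0.
have BE : eball r = [set x : 'rV[R]_n | (ball_vol x < v)%R].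
  by rewrite /v rV_lebesgue_eball_vol// eball_ball_vol.
(* s := inf S is the value of g^* on the boundary of the ball, so the bound
   int_B g^* <= s |B| + int (g^* - s)_+ is an equality. *)
pose S := [set t : R | (0 <= t)%R /\ mu [set x | (t < g x)%R] <= v%:E].
have hasS : has_inf S.
  split; last by exists 0%R => t [].
  (* By Markov's inequality the set where [g > v^-1] has volume at most [v]. *)
  exists (v^-1)%R; split; first by rewrite invr_ge0 ltW.
  have vi : (0 < v^-1)%R by rewrite invr_gt0.
  by have := markov_superlevel mg g0 g1 vi; rewrite lee_pdivrMl// mule1.
pose s := inf S.
have s0 : (0 <= s)%R by apply: lb_le_inf; [exact: hasS.1|move=> t []].
(* Otherwise a level [t] strictly between [G x] and [s] is outside [S]; then the set where [g > t]
   has volume above [v], so its rearrangement contains [x] and [G x > t]. *)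
have Gs x : eball r x -> s%:E <= G x.
  rewrite BE/= => xv; rewrite leNgt; apply/negP => Gxs.
  have [y Gy] : exists y, G x = y%:E.
    by exists (fine (G x)); rewrite fineK// ge0_fin_numE// (lt_trans Gxs)// ltry.
  have y0 : (0 <= y)%R by rewrite -lee_fin -Gy.
  move: Gxs; rewrite Gy lte_fin => ys.
  pose t := ((y + s) / 2)%R.
  have yt : (y < t)%R by rewrite /t; lra.
  have ts : (t < s)%R by rewrite /t; lra.
  have t0 : (0 < t)%R by exact: le_lt_trans yt.
  have : ~ S t by move=> /(ge_inf hasS.2); rewrite leNgt ts.
  apply; split; first exact: ltW.
  rewrite leNgt; apply/negP => vt.
  have : t%:E < G x by rewrite lt_rearrangement// (lt_trans _ vt)// lte_fin.
  by rewrite Gy lte_fin ltNge (ltW yt).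
have Gs' x : ~ eball r x -> G x <= s%:E.
  rewrite BE/= => /negP; rewrite -leNgt => vx; apply/lee_addgt0Pr => e e0.
  have [t [t0 tv] tse] := inf_adherent e0 hasS.
  apply: (@le_trans _ _ t%:E); last by rewrite -EFinD lee_fin ltW.
  (* [lt_rearrangement] covers positive levels, so [t = 0] is approached by levels [u > 0]. *)
  have [t00|] := ltP 0%R t; last first.
    move=> t0'; have {t0 t0'} t00 : t = 0%R by apply/eqP; rewrite eq_le t0' t0.
    apply/lee_addgt0Pr => u u0; rewrite t00 add0e leNgt lt_rearrangement//.
    rewrite -leNgt (@le_trans _ _ v%:E) ?lee_fin//; apply: le_trans tv.
    by apply: superlevel_nonincreasing => //; rewrite t00 ltW.
  rewrite leNgt lt_rearrangement// -leNgt (le_trans tv)// lee_fin//.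
have hsE (y : \bar R) : s%:E <= y -> s%:E + maxe (y - s%:E) 0 = y.
  case: y => [y| |].
  - rewrite lee_fin => sy; rewrite -EFinB max_l ?lee_fin ?subr_ge0//.
    by rewrite -EFinD addrC subrK.
  - by move=> _; rewrite addye// max_l ?leey// addey.
  - by rewrite leeNy_eq.
have hsle (y : \bar R) : 0 <= y -> y <= s%:E + maxe (y - s%:E) 0.
  move=> y0; have [/hsE ->//|/ltW ys] := leP s%:E y.
  by rewrite (le_trans ys)// leeDl// le_max lexx orbT.
have h0 (K : 'rV[R]_n -> \bar R) x : 0 <= ehinge s K x by rewrite le_max lexx orbT.
have mh (K : 'rV[R]_n -> \bar R) : measurable_fun setT K ->
  measurable_fun (eball r) (ehinge s K).
  by move=> mK; apply: measurable_funTS; exact: measurable_ehinge.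
have IB (K : 'rV[R]_n -> \bar R) : measurable_fun setT K ->
    \int[mu]_(x in eball r) (s%:E + ehinge s K x) =
    s%:E * mu (eball r) + \int[mu]_(x in eball r) ehinge s K x.
  move=> mK; rewrite ge0_integralD//; [by rewrite integral_cst|exact: mh].
apply: (@le_trans _ _ (\int[mu]_(x in eball r) (s%:E + ehinge s F x))).
  apply: ge0_le_integral => //.
  - exact: measurable_funTS.
  - by apply: emeasurable_funD => //; exact: mh.
  - by move=> x _; exact: hsle.
rewrite IB//; apply: (@le_trans _ _ (s%:E * mu (eball r) + \int[mu]_x ehinge s G x)).
  rewrite leeD2l//; apply: (@le_trans _ _ (\int[mu]_x ehinge s F x)).
    by apply: ge0_subset_integral => //; exact: measurable_ehinge.
  rewrite !hinge_rearrangement//; exact: fg.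
rewrite (_ : \int[mu]_x ehinge s G x = \int[mu]_(x in eball r) ehinge s G x); last first.
  rewrite [RHS]integral_mkcond; apply: eq_integral => x _.
  rewrite patchE; case: ifPn => //; rewrite notin_setE => /Gs' Gxs.
  by rewrite /ehinge max_r// sube_le0.
rewrite -IB//; apply: ge0_le_integral => //.
- by move=> x _; rewrite adde_ge0.
- by apply: emeasurable_funD => //; exact: mh.
- exact: measurable_funTS.
- by move=> x /Gs; rewrite /ehinge => /hsE ->.
Qed.

End majorization.

(** * Entropies *)

Section kernel_comparison.
Context (R : realType) (n : nat).
Local Open Scope ereal_scope.
Notation mu := (rV_lebesgue R n).
Notation leb := (@lebesgue_measure R).
Variables (phi : R -> R -> R) (w : R -> R).
Hypothesis mphi : measurable_fun setT (fun p : R * measurableTypeR R => phi p.1 p.2).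
Hypothesis mw : measurable_fun setT (w : measurableTypeR R -> R).
(** Nonnegativity is tied to the support of the weight because [Num.min y s] is negative for
    [s < 0]. *)
Hypothesis phi0 : forall y s : R, (0 <= y)%R -> (w s != 0 -> 0 <= phi y s)%R.
Hypothesis w0 : forall s, (0 <= w s)%R.

Lemma kernel_ge0 (y s : R) : (0 <= y)%R -> (0 <= phi y s * w s)%R.
Proof.
move=> y0; have [->|ws] := eqVneq (w s) 0%R; first by rewrite mulr0.
by rewrite mulr_ge0// phi0.
Qed.

Definition kernel_integral (y : R) : \bar R := \int[leb]_s (phi y s * w s)%:E.

Section one.
Variable f : 'rV[R]_n -> R.
Hypothesis mf : measurable_fun setT f.
Hypothesis f0 : forall x, (0 <= f x)%R.

Let mk : measurable_fun setT (fun p : 'rV[R]_n * measurableTypeR R =>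
  (phi (f p.1) p.2 * w p.2)%:E).
Proof.
apply/measurable_EFinP; apply: measurable_funM.
  have mf1 : measurable_fun setT (fun p : 'rV[R]_n * measurableTypeR R => (f p.1, p.2)).
    by apply: measurable_fun_pair => //; exact: measurableT_comp.
  exact: (measurableT_comp mphi mf1).
exact: (measurableT_comp mw).
Qed.

Let k0 p : 0 <= (fun p : 'rV[R]_n * measurableTypeR R => (phi (f p.1) p.2 * w p.2)%:E) p.
Proof. by rewrite lee_fin kernel_ge0. Qed.

Lemma integral_kernel : \int[mu]_x kernel_integral (f x) =
  \int[leb]_s \int[mu]_x (phi (f x) s * w s)%:E.
Proof. exact: (fubini_tonelli _ mk k0). Qed.

Lemma measurable_kernel_section : measurable_fun setT
  (fun s : measurableTypeR R => \int[mu]_x (phi (f x) s * w s)%:E).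
Proof. exact: (measurable_fun_fubini_tonelli_G _ mk k0). Qed.

Lemma integral_kernel_section (s : R) : w s != 0%R ->
  \int[mu]_x (phi (f x) s * w s)%:E = \int[mu]_x (phi (f x) s)%:E * (w s)%:E.
Proof.
move=> ws; under eq_integral do rewrite EFinM.
apply: ge0_integralZr => //; last 2 first.
- by move=> x _; rewrite lee_fin phi0.
- by rewrite lee_fin.
apply/measurable_EFinP.
have mfs : measurable_fun setT (fun x : 'rV[R]_n => (f x, s : measurableTypeR R)).
  by apply: measurable_fun_pair.
exact: (measurableT_comp mphi mfs).
Qed.

End one.

Lemma le_integral_kernel (f g : 'rV[R]_n -> R) :
  measurable_fun setT f -> (forall x, (0 <= f x)%R) ->
  measurable_fun setT g -> (forall x, (0 <= g x)%R) ->
  (forall s, w s != 0%R -> \int[mu]_x (phi (f x) s)%:E <= \int[mu]_x (phi (g x) s)%:E) ->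
  \int[mu]_x kernel_integral (f x) <= \int[mu]_x kernel_integral (g x).
Proof.
move=> mf f0 mg g0 fg; rewrite !integral_kernel//; apply: ge0_le_integral => //.
- by move=> s _; apply: integral_ge0 => x _; rewrite lee_fin kernel_ge0.
- exact: measurable_kernel_section.
- exact: measurable_kernel_section.
- move=> s _; have [ws|ws] := eqVneq (w s) 0%R.
    by rewrite ws; under eq_integral do rewrite mulr0; under [leRHS]eq_integral do rewrite mulr0.
  rewrite !integral_kernel_section//.
  by apply: lee_wpmul2r; [rewrite lee_fin|exact: fg].
Qed.

End kernel_comparison.


(** * Integrals of powers near 0 and at infinity *)

Section power_integrals.
Context (R : realType).
Local Open Scope ereal_scope.
Notation leb := (@lebesgue_measure R).

Lemma integral_is_derive (F f : R -> R) (a b : R) : (0 < a)%R -> (a < b)%R ->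
  (forall x : R, (0 < x)%R -> is_derive x 1%R F (f x)) ->
  (forall x : R, (0 < x)%R -> derivable f x 1%R) ->
  \int[leb]_(u in `[a, b]) (f u)%:E = (F b - F a)%:E.
Proof.
move=> a0 ab dF df.
have cont (g : R -> R) (x : R) : derivable g x 1%R -> {for x, continuous g}.
  by move=> /derivable1_diffP/differentiable_continuous.
have dF' (x : R) : (0 < x)%R -> derivable F x 1%R by move=> x0; have [] := dF x x0.
rewrite (@continuous_FTC2 _ f F a b ab) ?EFinB//.
- apply: derivable_within_continuous => x; rewrite in_itv/= => /andP[ax _].
  exact/df/(lt_le_trans a0).
- split.
  + by move=> x; rewrite in_itv/= => /andP[ax _]; exact/dF'/(lt_trans a0).
  + by apply: cvg_at_right_filter; exact/cont/dF'.
  + by apply: cvg_at_left_filter; exact/cont/dF'/(lt_trans a0).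
- move=> x; rewrite in_itv/= => /andP[ax _].
  by rewrite derive1E; have [_] := dF x (lt_trans a0 ax).
Qed.

Lemma integral_powR (q a b : R) : (q + 1 != 0)%R -> (0 < a)%R -> (a <= b)%R ->
  \int[leb]_(u in `[a, b]) (u `^ q)%R%:E =
  ((b `^ (q + 1) - a `^ (q + 1)) / (q + 1))%R%:E.
Proof.
move=> q1 a0; rewrite le_eqVlt => /predU1P[<-|ab].
  by rewrite set_itv1 integral_set1 subrr mul0r.
have dF (x : R) : (0 < x)%R ->
    is_derive x 1%R (fun x => (q + 1)^-1 * x `^ (q + 1))%R (x `^ q)%R.
  move=> x0; have h := is_deriveZ (q + 1)^-1%R (is_derive1_powR (q + 1) x0).
  apply: (is_derive_eq h).
  by rewrite /GRing.scale/= mulrA mulVf// mul1r addrK.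
have df (x : R) : (0 < x)%R -> derivable (fun x => x `^ q)%R x 1%R.
  by move=> x0; have [] := is_derive1_powR q x0.
by rewrite (integral_is_derive a0 ab dF df) -mulrBr mulrC.
Qed.

Lemma integral_inv (a b : R) : (0 < a)%R -> (a <= b)%R ->
  \int[leb]_(u in `[a, b]) (u^-1)%:E = (ln b - ln a)%:E.
Proof.
move=> a0; rewrite le_eqVlt => /predU1P[<-|ab].
  by rewrite set_itv1 integral_set1 subrr.
have dF (x : R) : (0 < x)%R -> is_derive x 1%R (@ln R) (x^-1)%R.
  exact: is_derive1_ln.
have df (x : R) : (0 < x)%R -> derivable (fun x : R => x^-1)%R x 1%R.
  by move=> x0; apply: derivableV; rewrite ?gt_eqF.
by rewrite (integral_is_derive a0 ab dF df).
Qed.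

Lemma measurable_powR_restrict (q : R) (D : set (measurableTypeR R)) :
  measurable_fun D (fun u : measurableTypeR R => ((u : R) `^ q)%:E).
Proof. by apply/measurable_EFinP; apply: measurable_funTS; exact: measurable_powR. Qed.

(** The integrals over the intervals from 1/(i+1) to 1 increase to this one and stay below
    [(q + 1)^-1]. *)
Lemma integral_powR01_lty (q : R) : (- 1 < q)%R ->
  \int[leb]_(u in `]0%R, 1%R]) (u `^ q)%R%:E < +oo.
Proof.
move=> q1; have q10 : (0 < q + 1)%R by lra.
apply: (@le_lt_trans _ _ ((q + 1)^-1)%:E); last exact: ltry.
pose F (i : nat) : set (measurableTypeR R) := `[i.+1%:R^-1%R, 1%R]%classic.
have mF i : measurable (F i) by exact: measurable_itv.
have ndF : {homo F : i j / (i <= j)%N >-> (i <= j)%O}.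
  move=> i j ij; apply/subsetPset => x; rewrite /F/= !in_itv/= => /andP[ix ->].
  by rewrite andbT (le_trans _ ix)// lef_pV2 ?posrE// ler_nat.
have FU : `]0%R, 1%R]%classic = \bigcup_i F i.
  apply/seteqP; split => [x /=|x [i _]]; rewrite /F/= !in_itv/=.
    move=> /andP[x0 x1].
    have := near_infty_natSinv_lt (PosNum x0) => -[k _ /(_ k (leqnn _))]/= kx.
    by exists k => //; rewrite /F/= in_itv/= x1 ltW.
  by move=> /andP[ix ->]; rewrite andbT (lt_le_trans _ ix).
have mf i := @measurable_powR_restrict q (F i).
have f0 i (x : measurableTypeR R) : F i x -> 0 <= ((x : R) `^ q)%:E by rewrite lee_fin powR_ge0.
have := ge0_nondecreasing_set_cvg_integral (mu := leb) ndF mF mf f0.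
rewrite FU => cF; rewrite -(cvg_lim _ cF)//; apply: lime_le.
  by apply/cvg_ex; eexists; exact: cF.
apply: nearW => i; rewrite integral_powR ?gt_eqF ?invf_le1 ?ler1n//.
by rewrite lee_fin powR1 -[leRHS]mul1r ler_pM2r ?invr_gt0// gerBl powR_ge0.
Qed.

Lemma integral_powR1y_lty (q : R) : (q < - 1)%R ->
  \int[leb]_(u in `]1%R, +oo[) (u `^ q)%R%:E < +oo.
Proof.
move=> q1; have q10 : (0 < - (q + 1))%R by lra.
apply: (@le_lt_trans _ _ ((- (q + 1))^-1)%:E); last exact: ltry.
pose F (i : nat) : set (measurableTypeR R) := `]1%R, i.+1%:R%R]%classic.
have mF i : measurable (F i) by exact: measurable_itv.
have ndF : {homo F : i j / (i <= j)%N >-> (i <= j)%O}.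
  move=> i j ij; apply/subsetPset => x; rewrite /F/= !in_itv/= => /andP[-> xi].
  by rewrite (le_trans xi)// ler_nat.
have FU : `]1%R, +oo[%classic = \bigcup_i F i.
  apply/seteqP; split => [x /=|x [i _]]; rewrite /F/= !in_itv/= ?andbT.
    move=> x1; exists (Num.truncn x) => //; rewrite /F/= in_itv/= x1/=.
    by rewrite ltW// truncnS_gt.
  by move=> /andP[].
have mf i := @measurable_powR_restrict q (F i).
have f0 i (x : measurableTypeR R) : F i x -> 0 <= ((x : R) `^ q)%:E by rewrite lee_fin powR_ge0.
have := ge0_nondecreasing_set_cvg_integral (mu := leb) ndF mF mf f0.
rewrite FU => cF; rewrite -(cvg_lim _ cF)//; apply: lime_le.
  by apply/cvg_ex; eexists; exact: cF.
apply: nearW => i; rewrite integral_itv_obnd_cbnd; last exact: measurable_powR_restrict.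
have q1n : (q + 1 < 0)%R by lra.
rewrite integral_powR ?lt_eqF ?ler1n//.
rewrite lee_fin powR1 -[leLHS]opprK -mulNr -mulrN -invrN opprB -[leRHS]mul1r.
by rewrite ler_pM2r ?invr_gt0// gerBl powR_ge0.
Qed.

End power_integrals.

(** * Powers and y ln y as mixtures *)

Section entropy_kernels.
Context (R : realType).
Local Open Scope ereal_scope.
Notation leb := (@lebesgue_measure R).

(** Up to a constant factor, the second derivative of the power with exponent [a]. Mixing (y - s)_+
    for [a > 1], or min (y, s) for [0 < a < 1], against it yields a multiple of that power of
    [y]. *)
Definition power_weight (a : R) (s : R) : R := if (0 < s)%R then (s `^ (a - 2))%R else 0%R.

(** Second derivative of [y ln y], cut off at [M] because the integral of y / s diverges at
    infinity. *)
Definition inv_weight (M : R) (s : R) : R := if (0 < s <= M)%R then (s^-1)%R else 0%R.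

Lemma measurable_power_weight a : measurable_fun setT (power_weight a : measurableTypeR R -> R).
Proof.
apply: measurable_fun_if => //; first exact: measurable_fun_ltr.
by apply: measurable_funTS; exact: measurable_powR.
Qed.

Lemma measurable_inv_weight M : measurable_fun setT (inv_weight M : measurableTypeR R -> R).
Proof.
rewrite (_ : inv_weight M = (fun s => if (0 < s <= M)%R then (s `^ (-1))%R else 0%R)).
  apply: measurable_fun_if => //.
    by apply: measurable_and; [exact: measurable_fun_ltr|exact: measurable_fun_ler].
  by apply: measurable_funTS; exact: measurable_powR.
apply/funext => s; rewrite /inv_weight; case: ifPn => // /andP[s0 _].
by rewrite powR_inv1// ltW.
Qed.

End entropy_kernels.

Section power_kernels.
Context (R : realType).
Local Open Scope ereal_scope.
Notation leb := (@lebesgue_measure R).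

Let phih (y s : R) : R := Num.max (y - s)%R 0%R.
Let phim (y s : R) : R := Num.min y s.

Let mphih : measurable_fun setT (fun p : R * measurableTypeR R => phih p.1 p.2).
Proof. by apply: measurable_maxr => //; exact: measurable_funB. Qed.

Let mphim : measurable_fun setT (fun p : R * measurableTypeR R => phim p.1 p.2).
Proof. exact: measurable_minr. Qed.

Lemma power_weight_ge0 a (s : R) : (0 <= power_weight a s)%R.
Proof. by rewrite /power_weight; case: ifPn => // _; exact: powR_ge0. Qed.

Lemma inv_weight_ge0 M (s : R) : (0 <= inv_weight M s)%R.
Proof. by rewrite /inv_weight; case: ifPn => // /andP[s0 _]; rewrite invr_ge0 ltW. Qed.

Lemma power_weight_neq0 a (s : R) : power_weight a s != 0%R -> (0 < s)%R.
Proof. by rewrite /power_weight; case: ifPn => //; rewrite eqxx. Qed.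

Lemma inv_weight_neq0 M (s : R) : inv_weight M s != 0%R -> (0 < s <= M)%R.
Proof. by rewrite /inv_weight; case: ifPn => //; rewrite eqxx. Qed.

Section homogeneous.
Variables (phi : R -> R -> R) (a : R).
Hypothesis mphi : measurable_fun setT (fun p : R * measurableTypeR R => phi p.1 p.2).
Hypothesis phi_ge0 : forall y s : R, (0 <= y)%R -> (0 < s)%R -> (0 <= phi y s)%R.
Hypothesis phi_hom : forall c y s : R, (0 < c)%R -> phi (c * y) (c * s) = (c * phi y s)%R.
Hypothesis phi_0 : forall s : R, (0 < s)%R -> phi 0 s = 0%R.
Hypothesis phi_gt0 : forall s : R, (0 < s < 1)%R -> (0 < phi 1 s)%R.
Hypothesis a_gt0 : (0 < a)%R.

Let K := kernel_integral phi (power_weight a).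

Let msec y : measurable_fun setT (fun s : measurableTypeR R => (phi y s * power_weight a s)%:E).
Proof.
apply/measurable_EFinP; apply: measurable_funM; last exact: measurable_power_weight.
have mys : measurable_fun setT (fun s : measurableTypeR R => (y, s)).
  exact: pair1_measurable.
exact: (measurableT_comp mphi mys).
Qed.

Let sec0 y s : (0 <= y)%R -> (0 <= phi y s * power_weight a s)%R.
Proof.
move=> y0; apply: kernel_ge0 => //; last exact: power_weight_ge0.
by move=> ? ? ? /power_weight_neq0; exact: phi_ge0.
Qed.

(* Substitute s by y s. *)
Lemma kernel_integral_power y : (0 <= y)%R -> K y = (y `^ a)%R%:E * K 1%R.
Proof.
rewrite le_eqVlt => /predU1P[<-|y0].
  rewrite powR0 ?gt_eqF// mul0e; apply: integral0_eq => s _.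
  have [->|/power_weight_neq0 s0] := eqVneq (power_weight a s) 0%R; first by rewrite mulr0.
  by rewrite phi_0// mul0r.
have := @ge0_integral_affine R y 0%R (fun s => (phi y s * power_weight a s)%:E) y0 (msec y) _.
have h0 : forall x : measurableTypeR R, 0 <= (phi y x * power_weight a x)%:E.
  by move=> s; rewrite lee_fin sec0// ltW.
move=> /(_ h0); rewrite -/(K y).
have -> : (fun x : measurableTypeR R => (phi y (y * x + 0) * power_weight a (y * x + 0))%R%:E) =
    (fun s : measurableTypeR R => (y `^ (a - 1))%R%:E * (phi 1 s * power_weight a s)%:E).
  apply/funext => s; rewrite addr0 -{1}(mulr1 y) phi_hom// /power_weight pmulr_rgt0//.
  case: ifPn => s0; last by rewrite !mulr0 mule0.
  rewrite powRM ?(ltW y0) ?(ltW s0)// -EFinM; congr EFin.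
  have -> : (y `^ (a - 1) = y * y `^ (a - 2))%R.
    rewrite -{2}(powRr1 (ltW y0)) -powRD; first by congr (_ `^ _)%R; ring.
    by rewrite (gt_eqF y0) implybT.
  by ring.
rewrite ge0_integralZl//; last 2 first.
- by move=> s _; rewrite lee_fin sec0.
- by rewrite lee_fin powR_ge0.
(* The Jacobian of the substitution supplies the last factor [y], raising the exponent from [a - 1]
   to [a]. *)
rewrite -/(K 1%R) => /(congr1 (fun z => y%:E * z)).
rewrite !muleA -!EFinM divff ?gt_eqF// mul1e => KE.
rewrite [LHS](_ : _ = \int[leb]_s (phi y s * power_weight a s)%:E)// -KE.
by rewrite mulr_powRB1// ltW.
Qed.

(** A zero integral would make the integrand vanish almost everywhere, but it is positive on the
    whole interval from 0 to 1. *)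
Lemma kernel_integral1_gt0 : 0 < K 1%R.
Proof.
have K0 : 0 <= K 1%R by apply: integral_ge0 => s _; rewrite lee_fin sec0.
rewrite lt_neqAle K0 andbT; apply/eqP => /esym K1.
have : \int[leb]_s `|(phi 1 s * power_weight a s)%:E| = 0.
  rewrite -K1; apply: eq_integral => s _.
  by rewrite gee0_abs// lee_fin sec0.
move=> /(ae_eq_integral_abs leb measurableT (msec 1%R)).1 [N [mN N0 subN]].
have : leb (`]0%R, 1%R[ : set (measurableTypeR R)) <= leb N.
  apply: le_measure; rewrite ?inE//.
  move=> s; rewrite /= in_itv/= => s01; apply: subN => /= /(_ Logic.I) [].
  have /andP[s0 _] := s01.
  apply/eqP; rewrite gt_eqF// mulr_gt0 ?phi_gt0// /power_weight s0.
  exact: powR_gt0.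
by rewrite N0 lebesgue_measure_itv/= lte_fin ltr01 oppr0 adde0 lee_fin ler10.
Qed.

(** Homogeneity makes the mixture a constant [K 1] times the power; this constant is positive and
    finite, so it cancels and its value is never computed. *)
Lemma le_integral_powR n (f g : 'rV[R]_n -> R) : K 1%R < +oo ->
  measurable_fun setT f -> (forall x, (0 <= f x)%R) ->
  measurable_fun setT g -> (forall x, (0 <= g x)%R) ->
  (forall s, (0 < s)%R -> \int[rV_lebesgue R n]_x (phi (f x) s)%:E <=
    \int[rV_lebesgue R n]_x (phi (g x) s)%:E) ->
  \int[rV_lebesgue R n]_x (f x `^ a)%R%:E <= \int[rV_lebesgue R n]_x (g x `^ a)%R%:E.
Proof.
move=> Koo mf f0 mg g0 fg.
have K0 := kernel_integral1_gt0.
have IK (h : 'rV[R]_n -> R) : measurable_fun setT h -> (forall x, (0 <= h x)%R) ->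
    \int[rV_lebesgue R n]_x K (h x) = \int[rV_lebesgue R n]_x (h x `^ a)%R%:E * K 1%R.
  move=> mh h0; rewrite -ge0_integralZr//.
  - by apply: eq_integral => x _; rewrite kernel_integral_power.
  - by apply/measurable_EFinP; exact: (measurableT_comp (measurable_powR a) mh).
  - by move=> x _; rewrite lee_fin powR_ge0.
  - exact: ltW.
have := @le_integral_kernel R n phi (power_weight a) mphi (measurable_power_weight a) _
  (power_weight_ge0 a) f g mf f0 mg g0.
rewrite -/K !IK// lee_pmul2r//; last by rewrite ge0_fin_numE// ltW.
apply.
- by move=> y s y0 /power_weight_neq0; exact: phi_ge0.
- by move=> s /power_weight_neq0; exact: fg.
Qed.

End homogeneous.

Lemma le_integral_powR_hinge n (a : R) (f g : 'rV[R]_n -> R) : (1 < a)%R ->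
  measurable_fun setT f -> (forall x, (0 <= f x)%R) ->
  measurable_fun setT g -> (forall x, (0 <= g x)%R) ->
  (forall s, (0 < s)%R -> \int[rV_lebesgue R n]_x (hinge s f x)%:E <=
    \int[rV_lebesgue R n]_x (hinge s g x)%:E) ->
  \int[rV_lebesgue R n]_x (f x `^ a)%R%:E <= \int[rV_lebesgue R n]_x (g x `^ a)%R%:E.
Proof.
move=> a1; apply: (@le_integral_powR phih a mphih).
- by move=> y s _ _; rewrite /phih le_max lexx orbT.
- by move=> c y s c0; rewrite /phih -mulrBr maxr_pMr ?(ltW c0)// mulr0.
- by move=> s s0; rewrite /phih max_r// sub0r oppr_le0 ltW.
- by move=> s /andP[_ s1]; rewrite /phih lt_max subr_gt0 s1.
- exact: lt_trans a1.
(* The kernel at [y = 1] vanishes for [s >= 1] and is at most 1 below, where the weight is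
   integrable because [a - 2 > -1]. *)
apply: (@le_lt_trans _ _ (\int[leb]_(u in `]0%R, 1%R]) (u `^ (a - 2))%R%:E)); last first.
  by apply: integral_powR01_lty; lra.
rewrite [leRHS]integral_mkcond; apply: ge0_le_integral => //.
- move=> s _; rewrite lee_fin mulr_ge0 ?power_weight_ge0//.
  by rewrite /phih le_max lexx orbT.
- apply/measurable_EFinP; apply: measurable_funM; last exact: measurable_power_weight.
  by apply: measurable_maxr => //; exact: measurable_funB.
- apply/(measurable_restrictT _ (measurable_itv _)); exact: measurable_powR_restrict.
move=> s _; rewrite patchE; case: ifPn => [|].
  rewrite inE/= in_itv/= => /andP[s0 s1]; rewrite /power_weight s0 lee_fin -[leRHS]mul1r.
  rewrite ler_wpM2r ?powR_ge0// /phih max_l ?subr_ge0//.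
  by rewrite gerBl ltW.
rewrite notin_setE/= in_itv/= => /negP; rewrite /power_weight.
case: ifPn => [s0|_ _]; last by rewrite mulr0.
by rewrite -ltNge => s1; rewrite /phih max_r ?mul0r// subr_le0 ltW.
Qed.

Lemma le_integral_powR_min n (a : R) (f g : 'rV[R]_n -> R) : (0 < a < 1)%R ->
  measurable_fun setT f -> (forall x, (0 <= f x)%R) ->
  measurable_fun setT g -> (forall x, (0 <= g x)%R) ->
  (forall s, (0 < s)%R -> \int[rV_lebesgue R n]_x (Num.min (f x) s)%:E <=
    \int[rV_lebesgue R n]_x (Num.min (g x) s)%:E) ->
  \int[rV_lebesgue R n]_x (f x `^ a)%R%:E <= \int[rV_lebesgue R n]_x (g x `^ a)%R%:E.
Proof.
move=> /andP[a0 a1]; apply: (@le_integral_powR phim a mphim) => //.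
- by move=> y s y0 s0; rewrite /phim le_min y0 ltW.
- by move=> c y s c0; rewrite /phim minr_pMr ?(ltW c0).
- by move=> s s0; rewrite /phim min_l// ltW.
- by move=> s /andP[s0 _]; rewrite /phim lt_min ltr01.
(* At [y = 1] the minimum is [s] up to 1 and then 1, so the integrand has exponent [a - 1 > -1] near
   0 and [a - 2 < -1] at infinity. *)
pose A : set (measurableTypeR R) := `]0%R, 1%R]%classic.
pose B : set (measurableTypeR R) := `]1%R, +oo[%classic.
pose pA := (fun u : measurableTypeR R => ((u : R) `^ (a - 1))%R%:E) \_ A.
pose pB := (fun u : measurableTypeR R => ((u : R) `^ (a - 2))%R%:E) \_ B.
have mA : measurable_fun setT pA.
  apply/(measurable_restrictT _ (measurable_itv _)); exact: measurable_powR_restrict.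
have mB : measurable_fun setT pB.
  apply/(measurable_restrictT _ (measurable_itv _)); exact: measurable_powR_restrict.
have A0 s : 0 <= pA s by rewrite /pA patchE; case: ifPn; rewrite ?lee_fin ?powR_ge0.
have B0 s : 0 <= pB s by rewrite /pB patchE; case: ifPn; rewrite ?lee_fin ?powR_ge0.
apply: (@le_lt_trans _ _ (\int[leb]_s (pA s + pB s))); last first.
  rewrite ge0_integralD// -!integral_mkcond lte_add_pinfty//.
  - by apply: integral_powR01_lty; lra.
  - by apply: integral_powR1y_lty; lra.
apply: ge0_le_integral => //.
- move=> s _.
  have [->|/power_weight_neq0 s0] := eqVneq (power_weight a s) 0%R.
    by rewrite mulr0.
  by rewrite lee_fin mulr_ge0 ?power_weight_ge0// /phim le_min ler01 ltW.
- apply/measurable_EFinP; apply: measurable_funM; last exact: measurable_power_weight.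
  exact: measurable_minr.
- exact: emeasurable_funD.
move=> s _; rewrite /power_weight; case: ifPn => s0; last by rewrite mulr0 adde_ge0.
have [s1|s1] := leP s 1%R.
  rewrite (le_trans _ (leeDl _ (B0 s)))// /pA patchE mem_set; last by rewrite /A/= in_itv/= s0.
  rewrite lee_fin /phim min_r//.
  rewrite -{1}(powRr1 (ltW s0)) -powRD; last by rewrite (gt_eqF s0) implybT.
  by rewrite (_ : 1 + (a - 2) = a - 1)%R//; ring.
rewrite (le_trans _ (leeDr _ (A0 s)))// /pB patchE mem_set; last by rewrite /B/= in_itv/= s1.
by rewrite lee_fin /phim min_l ?mul1r// ltW.
Qed.

(** The integrand is 1 for [s] up to [y], and y / s from [y] to [M]. The result is [- y ln y] up to
    a term linear in [y], whose integral is fixed for densities. *)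
Lemma kernel_integral_ln (M y : R) : (0 <= y <= M)%R ->
  kernel_integral phim (inv_weight M) y = (y + y * ln M - y * ln y)%:E.
Proof.
move=> /andP[]; rewrite le_eqVlt => /predU1P[<- M0|y0 yM].
  rewrite !mul0r subr0 addr0; apply: integral0_eq => s _.
  have [->|/inv_weight_neq0/andP[s0 _]] := eqVneq (inv_weight M s) 0%R; first by rewrite mulr0.
  by rewrite /phim min_l ?mul0r// ltW.
pose A : set (measurableTypeR R) := `]0%R, y]%classic.
pose B : set (measurableTypeR R) := `]y, M]%classic.
pose pA := (fun u : measurableTypeR R => (\1_A u)%:E : \bar R).
pose pB := (fun u : measurableTypeR R => y%:E * ((u : R)^-1)%:E) \_ B.
have minv : measurable_fun B (fun u : measurableTypeR R => ((u : R)^-1)%:E).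
  apply: (@eq_measurable_fun _ _ _ _ _ (fun u : measurableTypeR R => ((u : R) `^ (-1))%R%:E)).
    move=> u; rewrite inE /B/= in_itv/= => /andP[yu _].
    by rewrite powR_inv1// ltW// (lt_trans y0).
  exact: measurable_powR_restrict.
have mA : measurable_fun setT pA.
  by apply/measurable_EFinP; apply: measurable_indic; exact: measurable_itv.
have mB : measurable_fun setT pB.
  by apply/(measurable_restrictT _ (measurable_itv _)); exact: measurable_funeM.
have B0 s : 0 <= pB s.
  rewrite /pB patchE; case: ifPn => //; rewrite inE /B/= in_itv/= => /andP[ys _].
  by rewrite -EFinM lee_fin mulr_ge0 ?invr_ge0 ?ltW// (lt_trans y0).
have -> : kernel_integral phim (inv_weight M) y = \int[leb]_s (pA s + pB s).
  apply: eq_integral => s _; rewrite /pA /pB patchE /inv_weight indicE.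
  have -> : (s \in A) = ((0 < s) && (s <= y))%R.
    by apply/idP/idP; rewrite inE /A/= in_itv.
  have -> : (s \in B) = ((y < s) && (s <= M))%R.
    by apply/idP/idP; rewrite inE /B/= in_itv.
  have [s0|s0] /= := ltP 0%R s; last first.
    by rewrite mulr0 add0e ltNge (le_trans s0 (ltW y0)).
  have [sy|sy] /= := leP s y.
    by rewrite (le_trans sy yM) /phim min_r// mulfV ?gt_eqF// adde0.
  rewrite add0e; case: ifPn => sM; last by rewrite mulr0.
  by rewrite /phim min_l ?ltW.
have IA : \int[leb]_s pA s = y%:E.
  transitivity (leb A).
    rewrite integral_indic//=; last exact: measurable_itv.
    by congr (leb _); exact: setIT.
  by rewrite /A lebesgue_measure_itv/= lte_fin y0 -EFinD subr0.
have mBset : measurable B by exact: measurable_itv.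
rewrite ge0_integralD//; last by move=> s _; rewrite lee_fin.
rewrite IA.
rewrite /pB -integral_mkcond ge0_integralZl//=; last 2 first.
- by move=> s; rewrite /B/= in_itv/= => /andP[ys _]; rewrite lee_fin invr_ge0 ltW// (lt_trans y0).
- by rewrite lee_fin ltW.
rewrite integral_itv_obnd_cbnd// integral_inv// -EFinM -EFinD; congr EFin.
by ring.
Qed.

End power_kernels.

(** * Shannon entropy of bounded densities *)

Section shannon.
Context (R : realType) (n : nat).
Local Open Scope ereal_scope.
Notation mu := (rV_lebesgue R n).

Let entropy_kernel (M y : R) : R := (y + y * ln M - y * ln y)%R.

(** The entropy may be infinite, so the identity [u + k = c f] is first rewritten as an equality of
    sums of nonnegative functions, with the positive and negative parts of [u] on opposite sides.
    The integral of the positive part is finite, so those of the negative part and of [k] are finite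
    or infinite together. *)
Lemma entropy_bounded_kernel (M : R) (f : 'rV[R]_n -> R) : (1 <= M)%R ->
  measurable_fun setT f -> (forall x, (0 <= f x <= M)%R) ->
  \int[mu]_x (f x)%:E = 1 ->
  - (\int[mu]_x (f x * ln (f x))%:E) =
  \int[mu]_x (entropy_kernel M (f x))%:E - (1 + ln M)%:E.
Proof.
move=> M1 mf f0M f1.
have f0 x : (0 <= f x)%R by case/andP : (f0M x).
have M0 : (0 < M)%R by exact: lt_le_trans M1.
have c0 : (0 <= 1 + ln M)%R by rewrite addr_ge0// ln_ge0.
set c := (1 + ln M)%R in c0 *.
pose k x := entropy_kernel M (f x).
pose u x := (f x * ln (f x))%R.
have ku x : (u x + k x = c * f x)%R by rewrite /u /k /entropy_kernel /c; ring.
have k0 x : (0 <= k x)%R.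
  rewrite /k /entropy_kernel; have [fx0|fx0] := eqVneq (f x) 0%R.
    by rewrite fx0 !mul0r subr0 addr0.
  have fxp : (0 < f x)%R by rewrite lt_neqAle eq_sym fx0 f0.
  rewrite -addrA -mulrBr addr_ge0// mulr_ge0// subr_ge0 ler_ln ?posrE//.
  by case/andP : (f0M x).
have mu_ : measurable_fun setT u.
  by apply: measurable_funM => //; exact: (measurableT_comp (@measurable_ln R) mf).
have mk : measurable_fun setT k.
  rewrite (_ : k = (fun x => c * f x - u x)%R).
    by apply: measurable_funB => //; exact: measurable_funM.
  by apply/funext => x; rewrite -ku addrC addKr.
have muE : measurable_fun setT (EFin \o u) by exact/measurable_EFinP.
have mkE : measurable_fun setT (EFin \o k) by exact/measurable_EFinP.
have mfE : measurable_fun setT (EFin \o f) by exact/measurable_EFinP.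
have mfcE : measurable_fun setT (fun x => (c * f x)%:E).
  by apply/measurable_EFinP; exact: measurable_funM.
have Icf : \int[mu]_x (c * f x)%:E = c%:E.
  under eq_integral do rewrite EFinM.
  rewrite ge0_integralZl//; first by rewrite f1 mule1.
  by move=> x _; rewrite lee_fin.
have pE x : ((EFin \o u)^\+ x) + (k x)%:E = ((EFin \o u)^\- x) + (c * f x)%:E.
  rewrite -(ku x) funeposE funenegE/= -!EFin_max -!EFinD; congr EFin.
  case: (boolP (0 <= u x)%R) => [uu|]; last rewrite -ltNge => /ltW uu.
    by rewrite max_l// max_r ?oppr_le0//; ring.
  by rewrite max_r// max_l ?oppr_ge0//; ring.
have pint : \int[mu]_x ((EFin \o u)^\+ x) + \int[mu]_x (k x)%:E =
    \int[mu]_x ((EFin \o u)^\- x) + c%:E.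
  rewrite -Icf -!ge0_integralD//.
  - by apply: eq_integral => x _; exact: pE.
  - exact: measurable_funeneg.
  - by move=> x _; rewrite lee_fin mulr_ge0.
  - exact: measurable_funepos.
  - by move=> x _; rewrite lee_fin.
have p0 : 0 <= \int[mu]_x ((EFin \o u)^\+ x) by exact: integral_ge0.
have n0 : 0 <= \int[mu]_x ((EFin \o u)^\- x) by exact: integral_ge0.
(* [k >= 0] gives [u <= c f], and [1 <= M] makes [c] nonnegative. *)
have pc : \int[mu]_x ((EFin \o u)^\+ x) <= c%:E.
  rewrite -Icf; apply: ge0_le_integral => //.
  - exact: measurable_funepos.
  - move=> x _; rewrite funeposE/= -EFin_max lee_fin ge_max mulr_ge0// andbT.
    by rewrite -ku lerDl.
have Ik0 : 0 <= \int[mu]_x (k x)%:E by apply: integral_ge0 => x _; rewrite lee_fin.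
rewrite [X in - X]integralE.
move: pint p0 n0 pc Ik0.
rewrite -[\int[mu]_x (entropy_kernel M (f x))%:E]/(\int[mu]_x (k x)%:E).
move: (\int[mu]_x (EFin \o u)^\+ x) (\int[mu]_x (EFin \o u)^\- x) (\int[mu]_x (k x)%:E).
case=> [p| |]//; case=> [q| |]//; case=> [r| |]//; rewrite -?EFinD.
  by move=> [prqc] _ _ _ _ /=; congr EFin; move: prqc; lra.
Qed.

Lemma shannon_entropy_le (M : R) (f g : 'rV[R]_n -> R) : (1 <= M)%R ->
  measurable_fun setT f -> (forall x, (0 <= f x <= M)%R) ->
  measurable_fun setT g -> (forall x, (0 <= g x <= M)%R) ->
  \int[mu]_x (f x)%:E = 1 -> \int[mu]_x (g x)%:E = 1 ->
  (forall s, (0 < s <= M)%R -> \int[mu]_x (Num.min (g x) s)%:E <=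
    \int[mu]_x (Num.min (f x) s)%:E) ->
  - (\int[mu]_x (g x * ln (g x))%:E) <= - (\int[mu]_x (f x * ln (f x))%:E).
Proof.
move=> M1 mf fM mg gM f1 g1 gf.
rewrite !(entropy_bounded_kernel M1)// leeD2r//.
have kE (h : 'rV[R]_n -> R) : (forall x, (0 <= h x <= M)%R) ->
  \int[mu]_x (entropy_kernel M (h x))%:E =
  \int[mu]_x kernel_integral (fun y s => Num.min y s) (inv_weight M) (h x).
  by move=> hM; apply: eq_integral => x _; rewrite kernel_integral_ln.
rewrite !kE//; apply: le_integral_kernel => //.
- exact: measurable_minr.
- exact: measurable_inv_weight.
- by move=> y s y0 /inv_weight_neq0/andP[s0 _]; rewrite le_min y0 ltW.
- exact: inv_weight_ge0.
- by move=> x; case/andP : (gM x).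
- by move=> x; case/andP : (fM x).
- by move=> s /inv_weight_neq0; exact: gf.
Qed.

End shannon.

(** * Comparison of Renyi entropies *)

Section renyi.
Context (R : realType) (n : nat).
Local Open Scope ereal_scope.
Notation mu := (rV_lebesgue R n).

Lemma min_hinge (f : 'rV[R]_n -> R) (s : R) x :
  (Num.min (f x) s + hinge s f x = f x)%R.
Proof.
rewrite /hinge; have [fs|fs] := leP (f x) s.
  by rewrite max_r ?addr0// subr_le0.
by rewrite max_l ?subr_ge0 ?ltW// addrC subrK.
Qed.

Variables (f g : 'rV[R]_n -> R).
Hypotheses (mf : measurable_fun setT f) (mg : measurable_fun setT g).
Hypotheses (f0 : forall x, (0 <= f x)%R) (g0 : forall x, (0 <= g x)%R).
Hypotheses (f1 : \int[mu]_x (f x)%:E = 1) (g1 : \int[mu]_x (g x)%:E = 1).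
Hypothesis fg : forall s : R, (0 <= s)%R ->
  \int[mu]_x (hinge s f x)%:E <= \int[mu]_x (hinge s g x)%:E.

(** The minimum and the hinge function add up to a density of mass 1, so a larger hinge integral
    leaves less for the minimum. *)
Lemma min_le_of_hinge (s : R) : (0 <= s)%R ->
  \int[mu]_x (Num.min (g x) s)%:E <= \int[mu]_x (Num.min (f x) s)%:E.
Proof.
move=> s0.
have split (h : 'rV[R]_n -> R) : measurable_fun setT h -> (forall x, (0 <= h x)%R) ->
    \int[mu]_x (h x)%:E = 1 ->
    \int[mu]_x (Num.min (h x) s)%:E + \int[mu]_x (hinge s h x)%:E = 1.
  move=> mh h0 <-; rewrite -ge0_integralD//.
  - by apply: eq_integral => x _; rewrite -EFinD min_hinge.
  - by move=> x _; rewrite lee_fin le_min h0.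
  - by apply/measurable_EFinP; exact: measurable_minr.
  - by move=> x _; rewrite lee_fin hinge_ge0.
  - by apply/measurable_EFinP; exact: measurable_hinge.
have h0 h : 0 <= \int[mu]_x (hinge s h x)%:E.
  by apply: integral_ge0 => x _; rewrite lee_fin hinge_ge0.
have m0 (h : 'rV[R]_n -> R) : (forall x, (0 <= h x)%R) -> 0 <= \int[mu]_x (Num.min (h x) s)%:E.
  by move=> h0'; apply: integral_ge0 => x _; rewrite lee_fin le_min h0'.
have := split f mf f0 f1; have := split g mg g0 g1.
have := fg s0; have := h0 f; have := h0 g; have := m0 f f0; have := m0 g g0.
move: (\int[mu]_x (hinge s f x)%:E) (\int[mu]_x (hinge s g x)%:E).
move: (\int[mu]_x (Num.min (f x) s)%:E) (\int[mu]_x (Num.min (g x) s)%:E).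
case=> [a| |]//; case=> [b| |]//; case=> [c| |]//; case=> [e| |]//.
rewrite -!EFinD !lee_fin => _ _ _ _ ce [be] [ac]; lra.
Qed.

Variable M : R.
(** Almost everywhere bounds by [M], expressed through hinge integrals so that they pass from one
    version of a density to any other. *)
Hypotheses (fM : \int[mu]_x (hinge M f x)%:E = 0) (gM : \int[mu]_x (hinge M g x)%:E = 0).
Hypothesis M1 : (1 <= M)%R.

Lemma renyi_entropy_le (a : R) : (0 < a)%R -> renyi_entropy a g <= renyi_entropy a f.
Proof.
move=> a0; rewrite /renyi_entropy.
have nneg (h : 'rV[R]_n -> R) : \int[mu]_x (h x `^ a)%R%:E \in `[0, +oo].
  by rewrite in_itv/= leey andbT; apply: integral_ge0 => x _; rewrite lee_fin powR_ge0.
case: eqVneq => [_|a1]; last first.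
  have [{}a1|{}a1|] := ltgtP a 1%R; last by move/eqP; rewrite (negbTE a1).
  - apply: lee_wpmul2l; first by rewrite lee_fin invr_ge0 subr_ge0 ltW.
    rewrite lee_lne//; apply: le_integral_powR_min => //; first by rewrite a0.
    by move=> s s0; apply: min_le_of_hinge; exact: ltW.
  - have a1' : ((1 - a)^-1 < 0)%R by rewrite invr_lt0 subr_lt0.
    rewrite leNgt lte_nmul2l ?lte_fin// -leNgt lee_lne//; apply: le_integral_powR_hinge => // s s0.
    by apply: fg; exact: ltW.
have M0 : (0 <= M)%R by exact: le_trans M1.
(* [shannon_entropy_le] asks for bounds at every point; capping at [M] provides them and changes the
   densities only on null sets. *)
pose tr (h : 'rV[R]_n -> R) x := Num.min (h x) M.
have mtr h : measurable_fun setT h -> measurable_fun setT (tr h).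
  by move=> mh; exact: measurable_minr.
have aetr h : measurable_fun setT h -> \int[mu]_x (hinge M h x)%:E = 0 ->
    {ae mu, forall x, tr h x = h x}.
  move=> mh hM.
  have : \int[mu]_x `|(hinge M h x)%:E| = 0.
    by rewrite -hM; apply: eq_integral => x _; rewrite gee0_abs// lee_fin hinge_ge0.
  have mhE : measurable_fun setT (fun x => (hinge M h x)%:E).
    by apply/measurable_EFinP; exact: measurable_hinge.
  move=> /(ae_eq_integral_abs mu measurableT mhE).1; apply: filterS => x /(_ Logic.I)[hx0].
  by rewrite -[RHS](min_hinge h M x) hx0 addr0.
have trb h : (forall x, (0 <= h x)%R) -> forall x, (0 <= tr h x <= M)%R.
  by move=> h0 x; rewrite le_min h0 M0 ge_min lexx orbT.
have trE h : measurable_fun setT h -> \int[mu]_x (hinge M h x)%:E = 0 ->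
    \int[mu]_x (h x * ln (h x))%:E = \int[mu]_x (tr h x * ln (tr h x))%:E.
  move=> mh hM; apply: ae_eq_integral => //.
  - apply/measurable_EFinP; apply: measurable_funM => //.
    exact: (measurableT_comp (@measurable_ln R) mh).
  - apply/measurable_EFinP; apply: measurable_funM; first exact: mtr.
    exact: (measurableT_comp (@measurable_ln R) (mtr _ mh)).
  - by apply: filterS (aetr h mh hM) => x /= -> _.
have tr1 h : measurable_fun setT h -> \int[mu]_x (hinge M h x)%:E = 0 ->
    \int[mu]_x (h x)%:E = 1 -> \int[mu]_x (tr h x)%:E = 1.
  move=> mh hM <-; apply: ae_eq_integral => //.
  - by apply/measurable_EFinP; exact: mtr.
  - exact/measurable_EFinP.
  - by apply: filterS (aetr h mh hM) => x /= -> _.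
rewrite trE// [in leRHS]trE//; apply: (shannon_entropy_le M1).
- exact: mtr.
- exact: trb.
- exact: mtr.
- exact: trb.
- exact: tr1.
- exact: tr1.
move=> s /andP[s0 sM].
have tmin h x : Num.min (tr h x) s = Num.min (h x) s.
  by rewrite /tr -minA (min_r sM).
under eq_integral do rewrite tmin.
under [leRHS]eq_integral do rewrite tmin.
by apply: min_le_of_hinge; exact: ltW.
Qed.

End renyi.

(** The two existence clauses keep the third from being vacuous; the third ranges over all versions
    because a density is fixed only up to null sets. *)
Theorem theorem2p3 (R : realType) (d : nat) (hd : (0 < d)%N)
  (dT : measure_display) (T : measurableType dT) (P : probability T R)
  (X W : {RV P >-> 'rV[R]_d})
  (lcX : log_concave P X) (lcW : log_concave P W) (indXW : independent P X W)
  (l : R) (hl : 0 < l < 1) :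
  [/\ exists f, is_density P (X \+ W) f,
      exists g, is_density P ((l \*: X) \+ W) g &
      forall f g : 'rV[R]_d -> R,
        is_density P (X \+ W) f -> is_density P ((l \*: X) \+ W) g ->
        majorized f g /\
        forall a : R, 0 < a -> (renyi_entropy a g <= renyi_entropy a f)%E].
Proof.
have [phiX [phiXNy cphiX dX]] := lcX; have [phiW [phiWNy cphiW dW]] := lcW.
set fX := fun x => _ in dX; set fW := fun x => _ in dW.
have lcfX : log_concave_fun fX by exact: log_concave_fun_expeR.
have lcfW : log_concave_fun fW by exact: log_concave_fun_expeR.
(* A bound on [fW] bounds both convolutions by the same [M], whatever the factor in front of [X]. *)
have [M fWM] : exists M, forall v, fW v <= M.
  case: (dW) => mfW fW0 _; apply: log_concave_fun_bounded => //.
  exact: density_integral1 dW.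
have Y1E : (fun w => 1 *: X w + W w) = X \+ W by apply/funext => w; rewrite /= scale1r.
have Y2E : (fun w => l *: X w + W w) = (l \*: X) \+ W by [].
have d1 := is_density_conv dX dW 1 indXW fWM.
have d2 := is_density_conv dX dW l indXW fWM.
set f0 := conv fX fW 1 in d1; set g0 := conv fX fW l in d2.
rewrite -Y1E -Y2E.
split; [by exists f0; exact: d1|by exists g0; exact: d2|move=> f g df dg].
have hinge_le s : 0 <= s -> (\int[rV_lebesgue R d]_x (hinge s f x)%:E <=
    \int[rV_lebesgue R d]_x (hinge s g x)%:E)%E.
  (* The passage to convolution densities is what makes the superlevel set [K] convex. *)
  move=> s0; rewrite (hinge_density_unique df d1 s0) (hinge_density_unique dg d2 s0).
  apply: (hinge_density_le d1 d2 s0) => e e0.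
  pose K := [set x | s < f0 x].
  have mK : measurable K by apply: measurable_superlevel; case: d1.
  have cK x y t : 0 < t < 1 -> K x -> K y -> K (t *: x + (1 - t) *: y).
    by move=> t01; apply: (conv_convex_superlevel dX dW fWM lcfX lcfW s0).
  have [a Ka] := contraction_probability dX dW lcfW indXW hl e0 mK cK.
  exists [set z | K (1 *: z + a)].
    by rewrite -[X in measurable X]setTI; exact: measurable_rV_affine.
  by split => //; rewrite rV_lebesgue_affine// invr1 expr1n mul1e.
have [mf f_ge0 _] := df; have [mg g_ge0 _] := dg.
have f1 := density_integral1 df; have g1 := density_integral1 dg.
split; first exact: majorized_hinge.
(* The Shannon case needs a bound of at least 1, so that [1 + ln M'] is nonnegative. *)
pose M' := Num.max M 1.
have M'1 : 1 <= M' by rewrite le_max lexx orbT.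
have M'0 : 0 <= M' by exact: le_trans M'1.
have hinge0 c : (\int[rV_lebesgue R d]_x (hinge M' (conv fX fW c) x)%:E = 0)%E.
  apply: integral0_eq => x _; rewrite /hinge max_r// subr_le0 le_max.
  by rewrite (conv_le dX dW c fWM).
have fM : (\int[rV_lebesgue R d]_x (hinge M' f x)%:E = 0)%E.
  by rewrite (hinge_density_unique df d1 M'0) hinge0.
have gM : (\int[rV_lebesgue R d]_x (hinge M' g x)%:E = 0)%E.
  by rewrite (hinge_density_unique dg d2 M'0) hinge0.
by move=> a a0; apply: (renyi_entropy_le mf mg f_ge0 g_ge0 f1 g1 hinge_le fM gM M'1).
Qed.
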